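(* Let $f, g \in \mathcal{F}_{\text{ND}}$ be non-empty, with $\operatorname{dom}(f) = [a_f, u_f]$, $\operatorname{dom}(g) = [a_g, u_g]$ and $a_f \leq g(a_g)$, and let $\beta_f$, $\beta_g$ be any chains representing $f$ and $g$, with $\phi_f$ and $\phi_g$ breakpoints respectively. Then the algorithm $\textit{compose}$ (given in the context), run on $(\beta_f, \beta_g)$, returns $\bot$ if and only if $f \circ g$ is empty, and otherwise returns a chain representing $f \circ g$, of at most $\phi_f + \phi_g$ breakpoints, in $\mathcal{O}(\phi_f + \phi_g)$ operations. The returned chain is the canonical chain of $f \circ g$ up to redundant points and a trailing vertical.
   Context: Functions. A function $h : [a_h, u_h] \to \mathbb{R}$, with $a_h \leq u_h$ real, belongs to $\mathcal{F}_{\text{ND}}$ if it is non-decreasing, left-continuous at every $t \in (a_h, u_h]$ and affine on each of finitely many open pieces cutting $[a_h, u_h]$. The empty partial function $\bot$ is adjoined to $\mathcal{F}_{\text{ND}}$; ''non-empty'' means different from $\bot$. $\operatorname{dom}(h) = [a_h,u_h]$, and $h(t^+)$ is the right limit at $t<u_h$. The composition $f\circ g$ is the pointwise composition of partial functions: $\operatorname{dom}(f \circ g) = \{t \in \operatorname{dom}(g) : g(t) \in \operatorname{dom}(f)\}$, $(f \circ g)(t) = f(g(t))$; it is empty when this domain is empty. Chains. A chain is a finite sequence $\beta = ((x_1, y_1), \dots, (x_\phi, y_\phi))$ of points of $\mathbb{R}^2$, $\phi \in \mathbb{N}_{\geq 0}$, with $x_k \leq x_{k+1}$, $y_k \leq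 y_{k+1}$ and no two consecutive points equal; $\phi$ is its breakpoint count, and the chain with $\phi=0$ is the empty chain, written $\bot$. The selected function $\mathsf{s}(\beta)$ of a non-empty chain is the function on $[x_1, x_\phi]$ that takes, at an abscissa $t = x_k$ of the chain, the smallest ordinate carried at $t$, and, at any other $t$, the linear interpolation between the two consecutive chain points enclosing $t$; $\mathsf{s}(\bot)=\bot$. A chain $\beta$ represents $f$ when $\mathsf{s}(\beta) = f$. The chain of $f$ is written $\beta_f = ((x^f_1, y^f_1), \dots, (x^f_{\phi_f}, y^f_{\phi_f}))$. A vertical run is a maximal group of at least two consecutive points sharing an abscissa; a trailing vertical is a vertical run that is the last group of the chain (removing it means keeping only its point of smallest ordinate). A point of a chain is redundant if it lies inside a straight run of the chain (a vertical run included), i.e. on the segment joining its two neighbours. The canonical chain of a non-empty $h\in\mathcal{F}_{\text{ND}}$ lists, in increasing order of the cut abscissae $t_k$ of $h$ (the two endpoints of the domain and the abscissae where $h$ jumps or changes slope), the point $(t_k, h(t_k))$ followed by $(t_k, h(t_k^+))$ when $t_k<u_h$ and $h(t_k)<h(t_k^+)$. ''Up to redundant points and a trailing vertical'' means that the two chains agree after removal of such points. Algorithm $\textit{compose}$, on input $\beta_f,\beta_g$ (exact real arithmetic, unit-cost operations): 1. If $\phi_f = 0$ or $\phi_g = 0$, return $\bot$. 2. Set $\mathit{lo} := \max(x^f_1, y^g_1)$, $\mathit{hi} := \min(x^f_{\phi_f}, y^g_{\phi_g})$. If $\mathit{lo} > \mathit{hi}$, return $\bot$. 3. Set $i := \min\{i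 : x^f_i \geq \mathit{lo}\}$, $j := \min\{j : y^g_j \geq \mathit{lo}\}$, and let the output $\beta_h$ be empty. 4. While ($i \leq \phi_f$ and $x^f_i \leq \mathit{hi}$) or ($j \leq \phi_g$ and $y^g_j \leq \mathit{hi}$): (a) let $\mathit{ev}$ be the smallest of the available values $x^f_i$ and $y^g_j$ (a value being available when its index is within its chain); (b) let $\mathit{ys}$ be the list $(y^f_i, y^f_{i+1}, \dots)$ over all points with $x^f_i = \mathit{ev}$, advancing $i$ past them; (c) let $\mathit{ts}$ be the list $(x^g_j, x^g_{j+1}, \dots)$ over all points with $y^g_j = \mathit{ev}$, advancing $j$ past them; (d) if $\mathit{ys}$ is empty, set $\mathit{ys} := (f(\mathit{ev}))$, computed by linear interpolation on the piece $x^f_{i-1} < \mathit{ev} < x^f_i$; (e) if $\mathit{ts}$ is empty, set $\mathit{ts} := (t)$ with $t$ obtained by linear interpolation in the ordinate parameter on the piece $y^g_{j-1} < \mathit{ev} < y^g_j$, i.e. $t = x^g_{j-1} + (x^g_j - x^g_{j-1})(\mathit{ev}-y^g_{j-1})/(y^g_j-y^g_{j-1})$ (on a vertical run of $g$ this is its jump abscissa); (f) for each $t$ in $\mathit{ts}$, in order, $\textit{emit}(t, \mathit{ys}_1)$, where $\mathit{ys}_1$ is the first element of $\mathit{ys}$; (g) for each $y$ in $(\mathit{ys}_2, \mathit{ys}_3, \dots)$, in order, $\textit{emit}(\mathit{ts}_{\mathrm{last}}, y)$, where $\mathit{ts}_{\mathrm{last}}$ is the last element of $\mathit{ts}$. 5.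 Return $\beta_h$. Here $\textit{emit}(x,y)$ appends $(x,y)$ to $\beta_h$ unless it equals the last point of $\beta_h$ exactly. *)

(* Defs.v *)
From mathcomp Require Import all_boot all_order all_algebra.
From mathcomp Require Import boolp classical_sets reals topology normedtype.

Set Implicit Arguments.
Unset Strict Implicit.
Unset Printing Implicit Defensive.

Import Order.TTheory GRing.Theory Num.Theory numFieldNormedType.Exports.
Local Open Scope ring_scope.

Definition consecutive (T : Type) (s : seq T) : seq (T * T) := zip s (behead s).

Section Chains.
Variable R : realFieldType.
Implicit Types (b : seq (R * R)) (p q r : R * R) (t : R).

Definition is_chain b : bool :=
  sorted (fun p q => [&& p.1 <= q.1, p.2 <= q.2 & p != q]) b.

(* Value at [x] of the line through [(x0, y0)] and [(x1, y1)]. *)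
Definition lerp (x0 y0 x1 y1 x : R) : R :=
  y0 + (y1 - y0) * (x - x0) / (x1 - x0).

Definition ordinates_at b t : seq R := [seq p.2 | p <- b & p.1 == t].

Definition selected b t : option R :=
  if ordinates_at b t is y :: ys then Some (foldr Num.min y ys)
  else omap (fun s : (R * R) * (R * R) => lerp s.1.1 s.1.2 s.2.1 s.2.2 t)
         (ohead [seq s <- consecutive b | s.1.1 < t < s.2.1]).

Definition on_segment p q r : Prop :=
  exists2 l : R, 0 <= l <= 1 &
    q = ((1 - l) * p.1 + l * r.1, (1 - l) * p.2 + l * r.2).

Definition vertex b k : R * R := nth (0, 0) b k.

Definition redundant b k : bool :=
  [&& 0 < k, k.+1 < size b
    & `[< on_segment (vertex b k.-1) (vertex b k) (vertex b k.+1) >]]%N.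

(* The points of a trailing vertical that its removal discards: those of the
   last group that do not carry its smallest ordinate. *)
Definition trailing b k : bool :=
  ((vertex b k).1 == (vertex b (size b).-1).1) &&
  has (fun p => (p.1 == (vertex b k).1) && (p.2 < (vertex b k).2)) b.

(* Discarding all these points at once agrees with discarding them one at a
   time, in any order. *)
Definition reduced b : seq (R * R) :=
  [seq vertex b k | k <- iota 0 (size b) & ~~ redundant b k && ~~ trailing b k].

Definition same_up_to_redundant_and_trailing b b' : Prop :=
  reduced b = reduced b'.

End Chains.

(* [Some (a, n)]: the computation ends with the result [a] after [n] unit-cost
   operations.  [None]: it fails (access outside of a chain, interpolation
   outside of a piece, iteration bound of a loop exceeded). *)
Definition run (A : Type) : Type := option (A * nat).

Definition fail {A : Type} : run A := None.

Definition pay {A : Type} (n : nat) (a : A) : run A := Some (a, n).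

Definition bind {A B : Type} (m : run A) (k : A -> run B) : run B :=
  if m is Some (a, c) then
    if k a is Some (b, d) then Some (b, (c + d)%N) else None
  else None.

Notation "'let*' x ':=' m 'in' k" := (bind m (fun x => k))
  (at level 200, x name, m at level 100, k at level 200, right associativity).

(* A while loop that fails when it needs more than [N] iterations. *)
Fixpoint while_loop {S : Type} (N : nat) (cond : S -> run bool)
    (body : S -> run S) (s : S) : run S :=
  let* c := cond s in
  if ~~ c then pay 0 s
  else if N is N'.+1 then
    let* s' := body s in while_loop N' cond body s'
  else fail.

Fixpoint foreach {S A : Type} (body : S -> A -> run S) (s : S) (l : seq A)
    : run S :=
  if l is a :: l' then
    let* s1 := pay 1 s in
    let* s2 := body s1 a in
    foreach body s2 l'
  else pay 1 s.

Section Compose.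
Variable R : realFieldType.
Implicit Types (b bf bg out : seq (R * R)) (key val : R * R -> R).

(* Chains are arrays: an access, as well as an append to the output, costs one
   operation.  Indices start at 0, so that index [i] here is [i + 1] in the
   customary numbering.  The chain of [f] is scanned with [key := fst],
   [val := snd] and the chain of [g] with the roles of the two coordinates
   exchanged. *)

Definition read b (i : nat) : run (R * R) :=
  if onth b i is Some p then pay 1 p else fail.

Definition within key b (i : nat) (hi : R) : run bool :=
  let* c := pay 1 (i < size b)%N in
  if c then let* p := read b i in pay 1 (key p <= hi) else pay 0 false.

Definition available key b (i : nat) : run (option R) :=
  let* c := pay 1 (i < size b)%N in
  if c then let* p := read b i in pay 0 (Some (key p)) else pay 0 None.

Definition next_event bf bg (i j : nat) : run R :=
  let* x := available fst bf i in
  let* y := available snd bg j in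
  match x, y with
  | Some x', Some y' => pay 1 (Num.min x' y')
  | Some x', None => pay 0 x'
  | None, Some y' => pay 0 y'
  | None, None => fail
  end.

(* The least [i] such that [key (b_i) >= lo], by linear search; fails when
   there is none. *)
Definition first_index key (N : nat) b (lo : R) : run nat :=
  while_loop N
    (fun i => let* p := read b i in pay 1 (key p < lo))
    (fun i => pay 1 i.+1)
    0%N.

(* The values of all the points with key [ev] from index [i] on, and the index
   past them. *)
Definition collect key val (N : nat) b (ev : R) (i : nat)
    : run (nat * seq R) :=
  while_loop N
    (fun s : nat * seq R =>
       let* c := pay 1 (s.1 < size b)%N in
       if c then let* p := read b s.1 in pay 1 (key p == ev) else pay 0 false)
    (fun s : nat * seq R =>
       let* p := read b s.1 in
       pay 2 (s.1.+1, rcons s.2 (val p)))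
    (i, [::]).

(* The payment covers the computation of [i - 1] and the six real operations of
   [lerp]. *)
Definition interpolate key val b (ev : R) (i : nat) : run R :=
  if i is i'.+1 then
    let* p := read b i' in
    let* q := read b i in
    if key p < ev < key q then pay 7 (lerp (key p) (val p) (key q) (val q) ev)
    else fail
  else fail.

Definition or_interpolate key val b (ev : R) (i : nat) (l : seq R)
    : run (seq R) :=
  let* c := pay 1 (nilp l) in
  if c then let* v := interpolate key val b ev i in pay 1 [:: v] else pay 0 l.

(* The first payment covers the emptiness test, the access to the last point
   and the comparison of its two coordinates. *)
Definition emit out (p : R * R) : run (seq (R * R)) :=
  let* dup := pay 4 (if out is q :: out' then last q out' == p else false) in
  if dup then pay 0 out else pay 1 (rcons out p).

Record state := State { idx_f : nat; idx_g : nat; output : seq (R * R) }.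

Definition main_cond bf bg (hi : R) (s : state) : run bool :=
  let* c := within fst bf (idx_f s) hi in
  if c then pay 0 true else within snd bg (idx_g s) hi.

Definition main_body (N : nat) bf bg (s : state) : run state :=
  let* ev := next_event bf bg (idx_f s) (idx_g s) in
  let* iys := collect fst snd N bf ev (idx_f s) in
  let* jts := collect snd fst N bg ev (idx_g s) in
  let* ys := or_interpolate fst snd bf ev iys.1 iys.2 in
  let* ts := or_interpolate snd fst bg ev jts.1 jts.2 in
  match ys, ts with
  | y1 :: ys', t1 :: ts' =>
      let* out1 := foreach (fun o t => emit o (t, y1)) (output s) ts in
      let* t_last := pay 1 (last t1 ts') in
      let* out2 := foreach (fun o y => emit o (t_last, y)) out1 ys' in
      pay 0 (State iys.1 jts.1 out2)
  | _, _ => fail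
  end.

(* The algorithm, each of its loops being given at most [N] iterations. *)
Definition compose_upto (N : nat) bf bg : run (seq (R * R)) :=
  let* e := pay 2 ((size bf == 0%N) || (size bg == 0%N)) in
  if e then pay 0 [::] else
  let* f_first := read bf 0 in
  let* g_first := read bg 0 in
  let* lo := pay 1 (Num.max f_first.1 g_first.2) in
  let* f_last := read bf (size bf).-1 in
  let* g_last := read bg (size bg).-1 in
  let* hi := pay 1 (Num.min f_last.1 g_last.2) in
  let* c := pay 1 (hi < lo) in
  if c then pay 0 [::] else
  let* i := first_index fst N bf lo in
  let* j := first_index snd N bg lo in
  let* s := while_loop N (main_cond bf bg hi) (main_body N bf bg)
              (State i j [::]) in
  pay 0 (output s).

(* On input [(bf, bg)] the algorithm terminates without failing and returns
   [bh] after [c] operations.  Asking for every large enough bound makes [bh]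
   and [c] unique by definition. *)
Definition compose_returns bf bg bh (c : nat) : Prop :=
  exists N0 : nat, forall N : nat, (N0 <= N)%N ->
    compose_upto N bf bg = Some (bh, c).

End Compose.

Section Functions.
Variable R : realType.
Local Open Scope classical_set_scope.

Definition pfun : Type := R -> option R.

Implicit Types (f g h : pfun) (t a u m : R).

Definition pbot : pfun := fun=> None.

Definition pdom h : set R := [set t | isSome (h t)].

(* Only meaningful on the domain, or in limits taken inside of it. *)
Definition pval h t : R := odflt 0 (h t).

Definition piecewise_affine h a u : Prop :=
  exists s : seq R,
    [/\ path <%R a s, last a s = u &
      forall c, c \in consecutive (a :: s) ->
        exists m d : R, forall t, c.1 < t < c.2 -> pval h t = m * t + d].

Definition FND_on h a u : Prop :=
  [/\ a <= u /\ pdom h = `[a, u],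
      forall x y, a <= x -> x <= y -> y <= u -> pval h x <= pval h y,
      forall t, a < t <= u -> pval h x @[x --> t^'-] --> pval h t &
      piecewise_affine h a u].

Definition FND h : Prop := h = pbot \/ exists a u : R, FND_on h a u.

Definition represents (b : seq (R * R)) f : Prop :=
  is_chain b /\ selected b = f.

Definition rlim h t : R := lim (pval h x @[x --> t^'+]).

Definition jumps h u t : bool := (t < u) && (pval h t < rlim h t).

Definition slope_along (F : set_system R) h m : Prop :=
  exists d : R, \forall x \near F, pval h x = m * x + d.

Definition changes_slope h a u t : Prop :=
  a < t < u /\
  exists m1 m2 : R,
    [/\ slope_along t^'- h m1, slope_along t^'+ h m2 & m1 <> m2].

Definition is_cut h a u t : Prop :=
  a <= t <= u /\ [\/ t = a, t = u, jumps h u t | changes_slope h a u t].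

Definition cut_points h u t : seq (R * R) :=
  (t, pval h t) :: (if jumps h u t then [:: (t, rlim h t)] else [::]).

(* [b] is the canonical chain of [h], a non-empty member of [FND]. *)
Definition is_canonical h (b : seq (R * R)) : Prop :=
  exists a u : R, FND_on h a u /\
  exists ts : seq R,
    [/\ sorted <%R ts, forall t, t \in ts <-> is_cut h a u t &
        b = flatten [seq cut_points h u t | t <- ts]].

End Functions.

Arguments pbot {R}.

(* Main.v *)
(* All chains are monotone polylines, so the value selected at [t] is the
   lowest ordinate of the polyline above [t], and inserting points on its
   segments changes nothing.  Sweeping both chains by increasing common
   coordinate (an abscissa of [f], an ordinate of [g]) refines them so that
   corresponding pieces lie over the same interval; on such a piece the
   composition of two affine maps is the affine map joining the emitted points.
   After each event, the output therefore represents the composition of the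
   functions of the two refined prefixes, which share their last coordinate.
   The comparison with the canonical chain does not depend on the algorithm:
   the reduced form of any chain contains exactly the points [(t, h t)] and
   [(t, h (t+))] over the cut abscissae of the function [h] that it represents,
   and a strictly sorted list is determined by its members. *)
Require Import Defs.
From mathcomp Require Import all_boot all_order all_algebra.
From mathcomp Require Import boolp classical_sets reals topology normedtype.
From mathcomp Require Import zify ring lra.

Set Implicit Arguments.
Unset Strict Implicit.
Unset Printing Implicit Defensive.

Import Order.TTheory GRing.Theory Num.Theory numFieldNormedType.Exports.
Local Open Scope ring_scope.

(** * Values selected on a chain *)

(** The hypothesis [a_f <= g(a_g)] makes [lo] the first ordinate of [g], so that only points of [f]
    are skipped at the start. Otherwise a jump of [g] across [a_f] could leave a domain open on the
    left, which no chain represents. The order of emission within an event matters. While [g] stays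
    at the level [ev], the composition takes the single value [f(ev)], the lowest ordinate of [f]
    there; hence every abscissa is emitted with the first ordinate before the output rises along the
    vertical run of [f]. An event is accordingly treated as one diagonal step, then horizontal
    steps, then vertical steps. Cost and breakpoints are amortised over the points not yet scanned,
    of which every event consumes at least one. An empty list is replaced by a singleton, so an
    event consuming [m] points of [f] and [n] of [g] emits at most
    [max(1, m) + max(1, n) - 1 <= m + n] points. *)

Section Selected.
Variable R : realFieldType.
Implicit Types (b s : seq (R * R)) (p q r : R * R) (t : R).

(** Repeated points are tolerated: before filtering, the emitted points repeat, for instance, when a
    vertical run of [g] crosses several points of a constant part of [f]. *)
Definition mono : rel (R * R) := fun p q => (p.1 <= q.1) && (p.2 <= q.2).

Lemma mono_trans : transitive mono.
Proof.
move=> q p r /andP[h1 h2] /andP[h3 h4].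
by rewrite /mono (le_trans h1 h3) (le_trans h2 h4).
Qed.

Lemma mono_refl : reflexive mono.
Proof. by move=> p; rewrite /mono !lexx. Qed.

Lemma chain_mono b : is_chain b -> sorted mono b.
Proof. by apply: sub_sorted => p q /and3P[h1 h2 _]; apply/andP. Qed.

Lemma path_mono_ge p s : path mono p s -> all (mono p) s.
Proof. exact: (order_path_min mono_trans). Qed.

Lemma lerp_right (x0 y0 x1 y1 : R) : x0 < x1 -> lerp x0 y0 x1 y1 x1 = y1.
Proof. by move=> lt01; rewrite /lerp; field; lra. Qed.

Lemma lerp_left (x0 y0 x1 y1 : R) : lerp x0 y0 x1 y1 x0 = y0.
Proof. by rewrite /lerp subrr mulr0 mul0r addr0. Qed.

Lemma lerp_bounds (x0 y0 x1 y1 x : R) :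
  x0 <= x <= x1 -> x0 < x1 -> y0 <= y1 -> y0 <= lerp x0 y0 x1 y1 x <= y1.
Proof.
move=> /andP[h1 h2] h3 h4; rewrite /lerp -mulrA.
have h5 : 0 <= (x - x0) / (x1 - x0) <= 1.
  by rewrite divr_ge0 ?ler_pdivrMr; lra.
nra.
Qed.

Lemma le_lerp (x0 y0 x1 y1 x x' : R) :
  x0 < x1 -> y0 <= y1 -> x <= x' -> lerp x0 y0 x1 y1 x <= lerp x0 y0 x1 y1 x'.
Proof.
move=> h1 h2 h3; rewrite /lerp lerD2l -!mulrA ler_wpM2l ?subr_ge0 //.
by rewrite ler_pM2r ?lerD2r ?invr_gt0 ?subr_gt0.
Qed.

Lemma lerp_gt (x0 y0 x1 y1 x : R) :
  x0 < x1 -> y0 < y1 -> x0 < x -> y0 < lerp x0 y0 x1 y1 x.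
Proof.
move=> h1 h2 h3; rewrite /lerp ltrDl divr_gt0 ?subr_gt0 //.
by rewrite mulr_gt0 ?subr_gt0.
Qed.

Lemma lerp_const (x0 y x1 x : R) : lerp x0 y x1 y x = y.
Proof. by rewrite /lerp subrr !mul0r addr0. Qed.

Lemma lerp_comp (t0 x0 y0 t1 x1 y1 t : R) : x0 < x1 -> t0 < t1 ->
  lerp x0 y0 x1 y1 (lerp t0 x0 t1 x1 t) = lerp t0 y0 t1 y1 t.
Proof. by move=> h1 h2; rewrite /lerp; field; apply/andP; split; lra. Qed.

(** A form of [selected] suited to induction on sorted lists. The test [t <= p.1] stops at the first
    point of a vertical run, which carries its smallest ordinate. *)
Fixpoint sel p s t : option R :=
  if s is q :: s' then
    if t <= p.1 then if t == p.1 then Some p.2 else None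
    else if t < q.1 then Some (lerp p.1 p.2 q.1 q.2 t) else sel q s' t
  else if t == p.1 then Some p.2 else None.

Lemma foldr_min_head (y : R) ys : all (>= y) ys -> foldr Num.min y ys = y.
Proof.
elim: ys => //= z ys IH /andP[h1 /IH ->]; exact: min_r.
Qed.

Lemma ordinates_lt s t : all (fun q => t < q.1) s -> ordinates_at s t = [::].
Proof.
elim: s => //= q s IH /andP[h1 /IH]; rewrite /ordinates_at /=.
by rewrite gt_eqF.
Qed.

Lemma edges_le p s t : path mono p s -> t <= p.1 ->
  [seq e <- consecutive (p :: s) | e.1.1 < t < e.2.1] = [::].
Proof.
elim: s p => //= q s IH p /andP[/andP[h1 _] h2] h3.
by rewrite le_gtF //=; apply: IH => //; apply: le_trans h1.
Qed.

Lemma selected_sel p s t : path mono p s -> selected (p :: s) t = sel p s t.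
Proof.
elim: s p => [|q s IH] p hp.
  by rewrite /selected /ordinates_at /= eq_sym; case: eqP.
have /= /andP[/andP[h1 h2] hq] := hp.
have hge : all (mono p) (q :: s) by exact: path_mono_ge.
case: (ltgtP t p.1) => [tp|pt|->].
- rewrite /selected ordinates_lt ?edges_le ?(ltW tp) //=.
  rewrite tp /=; apply: sub_all hge => r /andP[+ _]; exact: lt_le_trans.
- have Ep : ordinates_at (p :: q :: s) t = ordinates_at (q :: s) t.
    by rewrite /ordinates_at /= (lt_eqF pt).
  rewrite -IH // /selected Ep /= pt /=.
  case: ltP => // tq.
  rewrite ordinates_lt //=; rewrite tq /=.
  by apply: sub_all (path_mono_ge hq) => r /andP[+ _]; exact: lt_le_trans.
- rewrite /selected /ordinates_at /= eqxx /= -/(ordinates_at (q :: s) p.1).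
  rewrite foldr_min_head // all_map all_filter.
  by apply: sub_all hge => r /andP[_ /= ->]; exact: implybT.
Qed.

Lemma selectedE p s : path mono p s -> selected (p :: s) = sel p s.
Proof. by move=> hp; apply/funext => t; exact: selected_sel. Qed.

Lemma sel_gt p s t : path mono p s -> (last p s).1 < t -> sel p s t = None.
Proof.
elim: s p => [|q s IH] p /=; first by move=> _ h; rewrite gt_eqF.
move=> /andP[/andP[h1 h2] h3] h4.
have /allP hge := path_mono_ge h3.
have h5 : q.1 <= (last q s).1.
  have := mem_last q s; rewrite inE => /orP[/eqP->//|/hge/andP[] //].
have qt : q.1 < t by exact: le_lt_trans h4.
by rewrite leNgt (le_lt_trans h1 qt) ltNge ltW //= IH.
Qed.

Lemma sel_rcons p s q t : path mono p (rcons s q) ->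
  sel p (rcons s q) t =
  if t <= (last p s).1 then sel p s t
  else if t <= q.1 then Some (lerp (last p s).1 (last p s).2 q.1 q.2 t)
  else None.
Proof.
elim: s p => [|r s IH] p /=.
  rewrite andbT => /andP[h1 h2].
  case: ifPn => [tp|]; first by [].
  rewrite -ltNge => pt.
  case: (ltgtP t q.1) => // tq.
  by rewrite tq lerp_right // -tq.
move=> /andP[/andP[h1 h2] h3].
have h5 : r.1 <= (last r s).1.
  have := mem_last r s; rewrite inE => /orP[/eqP->//|hl].
  have /allP hge := path_mono_ge h3.
  by have /hge/andP[] : last r s \in rcons s q by rewrite mem_rcons inE hl orbT.
case: (leP t p.1) => tp.
  by rewrite (le_trans tp) ?(le_trans h1).
case: (ltP t r.1) => tr; first by rewrite (le_trans (ltW tr)).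
by rewrite IH.
Qed.

Lemma path_mono_cat p s1 q s2 :
  path mono p (s1 ++ q :: s2) = path mono p (rcons s1 q) && path mono q s2.
Proof. by rewrite -cat_rcons cat_path last_rcons. Qed.

Lemma sel_cat p s1 s2 t : path mono p (s1 ++ s2) -> t <= (last p s1).1 ->
  sel p (s1 ++ s2) t = sel p s1 t.
Proof.
elim/last_ind: s2 => [|s2 q IH]; first by rewrite cats0.
rewrite -rcons_cat => hp ht.
have hp' : path mono p (s1 ++ s2) by move: hp; rewrite rcons_path => /andP[].
rewrite sel_rcons // IH // ifT // (le_trans ht) //.
move: hp'; rewrite cat_path last_cat => /andP[_ /path_mono_ge/allP h].
by have := mem_last (last p s1) s2; rewrite inE => /orP[/eqP->//|/h/andP[]].
Qed.

Lemma sel_bounds p s t y : path mono p s -> sel p s t = Some y ->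
  [&& p.1 <= t, t <= (last p s).1, p.2 <= y & y <= (last p s).2].
Proof.
elim/last_ind: s t y => [|s q IH] t y.
  by move=> _ /=; case: eqP => // -> [<-]; rewrite !lexx.
move=> hp; rewrite sel_rcons // last_rcons.
have /andP[hs /andP[h1 h2]] : path mono p s && mono (last p s) q.
  by rewrite -rcons_path.
case: leP => ht.
  move=> /(IH _ _ hs)/and4P[-> h3 -> h5] /=.
  by rewrite (le_trans h3) //= (le_trans h5).
case: leP => // ht' [<-].
have h0 : mono p (last p s).
  have /allP := path_mono_ge hs; have := mem_last p s.
  by rewrite inE => /orP[/eqP-> _|h /(_ _ h)//]; rewrite mono_refl.
have /andP[h3 h4] := h0.
have /andP[h5 h6] : (last p s).2 <=
    lerp (last p s).1 (last p s).2 q.1 q.2 t <= q.2.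
  by apply: lerp_bounds => //; [rewrite ltW | exact: lt_le_trans ht'].
by rewrite h6 (le_trans h4) // (le_trans h3) ?ltW.
Qed.

(** Strictness is the point: once [f] is exhausted, the rest of [g] must avoid even the last
    abscissa of [f]. An edge leaving the last prefix point upwards is strictly above it at every
    later abscissa. *)
Lemma sel_gt_last p s1 s2 t y : path mono p (s1 ++ s2) ->
  (last p s1).1 < t -> all (fun q => (last p s1).2 < q.2) s2 ->
  sel p (s1 ++ s2) t = Some y -> (last p s1).2 < y.
Proof.
elim/last_ind: s2 y => [|s2 q IH] y.
  by rewrite cats0 => hp ht _; rewrite sel_gt.
rewrite -rcons_cat => hp ht; rewrite all_rcons => /andP[hq hs].
have /andP[hp' hm] : path mono p (s1 ++ s2) && mono (last p (s1 ++ s2)) q.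
  by rewrite -rcons_path.
rewrite sel_rcons //; case: (leP t) => ht1; first exact: IH.
case: (leP t) => // ht2 [<-].
move: ht1 hm; rewrite last_cat.
case: s2 {IH hp hp'} hs => [|r s2] hs ht1 /andP[h1 h2].
  by apply: lerp_gt => //; exact: lt_le_trans ht2.
have hl : (last p s1).2 < (last (last p s1) (r :: s2)).2.
  by move/allP: hs; apply; rewrite /= mem_last.
apply: (lt_le_trans hl).
set c := last _ _ in ht1 h1 h2 *.
by have /andP[] : c.2 <= lerp c.1 c.2 q.1 q.2 t <= q.2
  by apply: lerp_bounds => //; [rewrite ltW | exact: lt_le_trans ht2].
Qed.

Lemma on_segment_mono p q r : mono p r -> on_segment p q r ->
  mono p q && mono q r.
Proof.
by move=> /andP[h1 h2] [l /andP[l0 l1] ->]; rewrite /mono /=; nra.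
Qed.

Lemma lerp_segment_left p q r t : on_segment p q r -> p.1 < q.1 -> p.1 < r.1 ->
  lerp p.1 p.2 q.1 q.2 t = lerp p.1 p.2 r.1 r.2 t.
Proof.
case=> l _ -> /= h h'; rewrite /lerp; field.
by apply/andP; split; lra.
Qed.

Lemma lerp_segment_right p q r t : on_segment p q r -> q.1 < r.1 -> p.1 < r.1 ->
  lerp q.1 q.2 r.1 r.2 t = lerp p.1 p.2 r.1 r.2 t.
Proof.
case=> l _ -> /= h h'; rewrite /lerp; field.
by apply/andP; split; lra.
Qed.

Lemma sel_head p s : sel p s p.1 = Some p.2.
Proof. by case: s => [|q s] /=; rewrite ?lexx eqxx. Qed.

Lemma sel_congr p q s s' t :
  sel q s t = sel q s' t -> sel p (q :: s) t = sel p (q :: s') t.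
Proof. by move=> /= ->. Qed.

Lemma sel_segment p q r s t : path mono p (r :: s) -> on_segment p q r ->
  sel p (q :: r :: s) t = sel p (r :: s) t.
Proof.
move=> /= /andP[hpr hr] hq.
have /andP[/andP[h1 h2] /andP[h3 h4]] := on_segment_mono hpr hq.
case: (leP t p.1) => // tp.
have L : p.1 < q.1 -> p.1 < r.1 by move=> h; exact: lt_le_trans h3.
case: (ltP t q.1) => tq.
  rewrite (lt_le_trans tq h3) (lerp_segment_left _ hq) //.
    exact: lt_trans tq.
  by apply: L; exact: lt_trans tq.
case: (ltP t r.1) => tr.
  have qr : q.1 < r.1 by exact: le_lt_trans tr.
  have pr : p.1 < r.1 by exact: lt_trans tr.
  case: ltP => tq'; first by rewrite (lerp_segment_right _ hq).
  have -> : t = q.1 by apply/eqP; rewrite eq_le tq'.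
  by rewrite eqxx -(lerp_segment_right _ hq) // lerp_left.
(* In the case left, [t], [q.1] and [r.1] coincide and exceed [p.1]. The segment is thus not
   vertical, and [q] has the ordinate of [r]. *)
case: (leP t q.1) => // tq'.
have E1 : t = q.1 by apply/eqP; rewrite eq_le tq'.
have E2 : t = r.1 by apply/eqP; rewrite eq_le tr E1 h3.
have pq : p.1 < q.1 by rewrite -E1.
have E3 : q.1 = r.1 by rewrite -E1.
have pr : p.1 < r.1 by rewrite -E3.
rewrite E1 eqxx E3 sel_head; congr Some.
by have := lerp_segment_left q.1 hq pq pr; rewrite lerp_right // E3 lerp_right.
Qed.

(* Neither coordinate plays a special role here, so that the scans of both
   chains refine them in the same sense. *)
Definition refine s s' : Prop :=
  s = s' \/ exists p q r u,
    [/\ s = p :: r :: u, s' = p :: q :: r :: u & on_segment p q r].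

Lemma refine_cat s0 s s' : refine s s' -> sorted mono (s0 ++ s) ->
  sorted mono (s0 ++ s') /\ selected (s0 ++ s') = selected (s0 ++ s).
Proof.
case=> [-> //|[p [q [r [u [-> -> hq]]]]]].
case: s0 => [|p0 s0] h; split.
- move: h => /= /andP[/on_segment_mono/(_ hq)/andP[-> ->]] -> //.
- have h' : path mono p (q :: r :: u).
    by move: h => /= /andP[/on_segment_mono/(_ hq)/andP[-> ->]] ->.
  rewrite [LHS](selectedE h') [RHS](selectedE h) {h'}.
  by apply/funext => t; exact: sel_segment.
- move: h => /=; rewrite !path_mono_cat => /andP[->] /=.
  by move=> /andP[/on_segment_mono/(_ hq)/andP[-> ->]] ->.
- have h' : path mono p0 (s0 ++ p :: q :: r :: u).
    move: h => /=; rewrite !path_mono_cat => /andP[->] /=.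
    by move=> /andP[/on_segment_mono/(_ hq)/andP[-> ->]] ->.
  rewrite [LHS](selectedE h') [RHS](selectedE h) {h'}.
  apply/funext => t; elim: s0 p0 h => [|p1 s0 IH] p0 /andP[_ h].
    by apply: sel_congr; exact: sel_segment.
  by apply: sel_congr; exact: IH.
Qed.

End Selected.

Arguments mono {R}.

(** * Joining refined prefixes *)

Section Composite.
Variable R : realFieldType.
Implicit Types (F G O s : seq (R * R)) (p q : R * R) (t e y : R).

Lemma selected1 p t : selected [:: p] t = if t == p.1 then Some p.2 else None.
Proof. by rewrite selected_sel. Qed.

Lemma selected_rcons s q t : s != [::] -> sorted mono (rcons s q) ->
  selected (rcons s q) t =
  if t <= (last (0, 0) s).1 then selected s t
  else if t <= q.1
    then Some (lerp (last (0, 0) s).1 (last (0, 0) s).2 q.1 q.2 t) else None.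
Proof.
case: s => // p s _ hs.
rewrite rcons_cons !selected_sel ?sel_rcons //.
by move: hs; rewrite /= rcons_path => /andP[].
Qed.

Lemma selected_cat s s' t : s != [::] -> sorted mono (s ++ s') ->
  t <= (last (0, 0) s).1 -> selected (s ++ s') t = selected s t.
Proof.
case: s => // p s _ hs ht; rewrite cat_cons !selected_sel //; last first.
  by move: hs; rewrite /= cat_path => /andP[].
exact: sel_cat.
Qed.

Lemma selected_gt s t : s != [::] -> sorted mono s ->
  (last (0, 0) s).1 < t -> selected s t = None.
Proof. by case: s => // p s _ hs ht; rewrite selected_sel ?sel_gt. Qed.

Lemma selected_bounds s t y : s != [::] -> sorted mono s ->
  selected s t = Some y ->
  [&& (head (0, 0) s).1 <= t, t <= (last (0, 0) s).1,
      (head (0, 0) s).2 <= y & y <= (last (0, 0) s).2].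
Proof.
by case: s => // p s _ hs; rewrite selected_sel // => /sel_bounds ->.
Qed.

Lemma selected_gt_last s s' t y : s != [::] -> sorted mono (s ++ s') ->
  (last (0, 0) s).1 < t -> all (fun q => (last (0, 0) s).2 < q.2) s' ->
  selected (s ++ s') t = Some y -> (last (0, 0) s).2 < y.
Proof.
case: s => // p s _ hs ht hs'; rewrite cat_cons selected_sel //.
exact: sel_gt_last.
Qed.

Lemma sorted_mono_rcons s q : s != [::] ->
  sorted mono (rcons s q) = sorted mono s && mono (last (0, 0) s) q.
Proof. by case: s => // p s _; rewrite /= rcons_path. Qed.

Lemma rcons_neq0 s q : rcons s q != [::].
Proof. by case: s. Qed.

(** The condition on the last point of [O] fixes where its next edge starts, which the equality of
    functions alone does not: that point may be the top of a vertical run. *)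
Definition composite F G O : Prop :=
  [/\ [/\ F != [::], G != [::] & O != [::]],
      [/\ sorted mono F, sorted mono G & sorted mono O],
      (last (0, 0) F).1 = (last (0, 0) G).2,
      last (0, 0) O = ((last (0, 0) G).1, (last (0, 0) F).2) &
      selected O = pcomp (selected F) (selected G)].

(** To the right of its left end, the new edge of [g] has values strictly above the shared
    coordinate. So [f] is evaluated on its own new edge, even when it jumps at that coordinate, and
    two affine maps compose. *)
Lemma composite_diagonal F G O e t y : composite F G O ->
  (last (0, 0) F).1 < e -> sorted mono (rcons F (e, y)) ->
  sorted mono (rcons G (t, e)) ->
  composite (rcons F (e, y)) (rcons G (t, e)) (rcons O (t, y)).
Proof.
move=> [[F0 G0 O0] [sF sG sO] eFG eO sel_eq] lt_e sF' sG'.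
have /andP[_ /andP[h1 h2]] : sorted mono F && mono (last (0, 0) F) (e, y).
  by rewrite -sorted_mono_rcons.
have /andP[_ /andP[h3 h4]] : sorted mono G && mono (last (0, 0) G) (t, e).
  by rewrite -sorted_mono_rcons.
have sO' : sorted mono (rcons O (t, y)).
  by rewrite sorted_mono_rcons // sO eO /mono /= ?lexx ?h3 ?h2 ?h4.
split; rewrite ?last_rcons ?rcons_neq0 //.
apply/funext => x; rewrite /pcomp !selected_rcons // eO /=.
case: (leP x (last (0, 0) G).1) => hx.
  rewrite sel_eq /pcomp; case E : selected => [z|//] /=.
  have /and4P[_ _ _ hz] := selected_bounds G0 sG E.
  by rewrite selected_rcons // eFG hz.
case: (leP x t) => //= hx'.
set z := lerp (last (0, 0) G).1 (last (0, 0) G).2 t e x.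
have lt_t : (last (0, 0) G).1 < t by exact: lt_le_trans hx'.
have z1 : z <= e.
  have /andP[] // : (last (0, 0) G).2 <= z <= e.
  by rewrite /z; apply: lerp_bounds => //; rewrite ltW.
have z2 : (last (0, 0) G).2 < z.
  by rewrite /z; apply: lerp_gt => //; rewrite -eFG.
by rewrite selected_rcons //= eFG leNgt z2 z1 /= lerp_comp // -eFG.
Qed.

(** On a flat edge of [g], [f] is evaluated exactly at its last abscissa. The second hypothesis asks
    that the last point of [F] carry this value, which fails after an upward vertical step; hence
    horizontals come before verticals. *)
Lemma composite_horizontal F G O t : composite F G O ->
  selected F (last (0, 0) F).1 = Some (last (0, 0) F).2 ->
  sorted mono (rcons G (t, (last (0, 0) F).1)) ->
  composite F (rcons G (t, (last (0, 0) F).1))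
    (rcons O (t, (last (0, 0) F).2)).
Proof.
move=> [[F0 G0 O0] [sF sG sO] eFG eO sel_eq] hF sG'.
have /andP[_ /andP[h3 h4]] :
    sorted mono G && mono (last (0, 0) G) (t, (last (0, 0) F).1).
  by rewrite -sorted_mono_rcons.
have sO' : sorted mono (rcons O (t, (last (0, 0) F).2)).
  by rewrite sorted_mono_rcons // sO eO /mono /= ?lexx ?h3 ?h2 ?h4.
split; rewrite ?last_rcons ?rcons_neq0 //.
apply/funext => x; rewrite /pcomp !selected_rcons // eO /=.
case: (leP x (last (0, 0) G).1) => hx; first by rewrite sel_eq.
by case: (leP x t) => //= hx'; rewrite -eFG !lerp_const hF.
Qed.

(** A point added on top of a vertical run changes no selected value. It only moves the point from
    which the next edges of [F] and [O] start. *)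
Lemma composite_vertical F G O y : composite F G O ->
  sorted mono (rcons F ((last (0, 0) F).1, y)) ->
  composite (rcons F ((last (0, 0) F).1, y)) G
    (rcons O ((last (0, 0) G).1, y)).
Proof.
move=> [[F0 G0 O0] [sF sG sO] eFG eO sel_eq] sF'.
have /andP[_ /andP[h3 h4]] :
    sorted mono F && mono (last (0, 0) F) ((last (0, 0) F).1, y).
  by rewrite -sorted_mono_rcons.
have sO' : sorted mono (rcons O ((last (0, 0) G).1, y)).
  by rewrite sorted_mono_rcons // sO eO /mono /= ?lexx ?h3 ?h2 ?h4.
split; rewrite ?last_rcons ?rcons_neq0 //.
have EF : selected (rcons F ((last (0, 0) F).1, y)) = selected F.
  apply/funext => x; rewrite selected_rcons //=.
  by case: leP => // hx; rewrite selected_gt.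
rewrite EF -sel_eq; apply/funext => x; rewrite selected_rcons // eO /=.
by case: leP => // hx; rewrite selected_gt // eO.
Qed.

Lemma composite_horizontals F G O ts : composite F G O ->
  selected F (last (0, 0) F).1 = Some (last (0, 0) F).2 ->
  sorted mono (G ++ [seq (t, (last (0, 0) F).1) | t <- ts]) ->
  composite F (G ++ [seq (t, (last (0, 0) F).1) | t <- ts])
    (O ++ [seq (t, (last (0, 0) F).2) | t <- ts]).
Proof.
elim: ts G O => [|t ts IH] G O hc hF /=; first by rewrite !cats0.
rewrite -!cat_rcons => hG; apply: IH => //.
by apply: composite_horizontal => //; move: hG => /cat_sorted2[].
Qed.

Lemma composite_verticals F G O ys e : composite F G O ->
  (last (0, 0) F).1 = e ->
  sorted mono (F ++ [seq (e, y) | y <- ys]) ->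
  composite (F ++ [seq (e, y) | y <- ys]) G
    (O ++ [seq ((last (0, 0) G).1, y) | y <- ys]).
Proof.
elim: ys F O => [|y ys IH] F O hc hF /=; first by rewrite !cats0.
rewrite -!cat_rcons => hG; apply: IH => //; last by rewrite last_rcons.
have := composite_vertical (y := y) hc; rewrite hF; apply.
by move: hG => /cat_sorted2[].
Qed.

(** The second alternative describes the first event: [F] then holds the points of [f] to the left
    of [lo], which no value of [g] reaches. *)
Definition joinable F G O e : Prop :=
  (composite F G O /\ (last (0, 0) F).1 < e) \/
  [/\ G = [::], O = [::] & all (fun p => p.1 < e) F].

Definition merged ys ts : seq (R * R) :=
  [seq (t, head 0 ys) | t <- ts] ++ [seq (last 0 ts, y) | y <- behead ys].

Lemma composite_event F G O e y ys t ts : joinable F G O e ->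
  sorted mono (F ++ [seq (e, y') | y' <- y :: ys]) ->
  sorted mono (G ++ [seq (t', e) | t' <- t :: ts]) ->
  composite (F ++ [seq (e, y') | y' <- y :: ys])
    (G ++ [seq (t', e) | t' <- t :: ts]) (O ++ merged (y :: ys) (t :: ts)).
Proof.
rewrite /merged /= -!cat_rcons catA => hj hF hG.
have sF : sorted mono (rcons F (e, y)) by move: hF => /cat_sorted2[].
have sG : sorted mono (rcons G (t, e)) by move: hG => /cat_sorted2[].
(* [F] ends strictly before [e], so [y] is the lowest ordinate at [e]. The horizontal steps rely on
   this. *)
have hy : selected (rcons F (e, y)) e = Some y.
  have [->|F0] := eqVneq F [::]; first by rewrite selected1 eqxx.
  have lF : (last (0, 0) F).1 < e.
    case: hj => [[]//|[_ _ /allP]]; apply.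
    by case: F F0 {sF hF} => //= a F' _; exact: mem_last.
  by rewrite selected_rcons //= leNgt lF /= lexx lerp_right.
have hc : composite (rcons F (e, y)) (rcons G (t, e)) (rcons O (t, y)).
  case: hj => [[hc hl]|[-> -> hl]]; first exact: composite_diagonal.
  split; rewrite ?last_rcons ?rcons_neq0 //.
  apply/funext => x; rewrite /pcomp !selected1 /=.
  by case: eqP => //= _; rewrite hy.
have := composite_horizontals (ts := ts) hc; rewrite last_rcons /=.
move=> /(_ hy hG) {}hc.
have := composite_verticals (ys := ys) (e := e) hc; rewrite last_rcons.
move=> /(_ erefl hF).
suff -> : (last (0, 0) (rcons G (t, e) ++ [seq (t', e) | t' <- ts])).1
   = last t ts by [].
by rewrite last_cat last_rcons last_map.
Qed.

Definition emitted O p :=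
  if (if O is q :: O' then last q O' == p else false) then O else rcons O p.

Lemma emitted_last q O p : last q (emitted O p) = p.
Proof.
rewrite /emitted; case: O => [|a O] //=.
by case: eqP => [|_] /=; rewrite ?last_rcons.
Qed.

Lemma emitted_spec O p : is_chain O -> sorted mono (rcons O p) ->
  [/\ is_chain (emitted O p), selected (emitted O p) = selected (rcons O p),
      emitted O p != [::] & (size (emitted O p) <= (size O).+1)%N].
Proof.
rewrite /emitted; case: O => [|a O] // hO.
case: eqP => [E|/eqP E] hp.
  split => //; apply/funext => t; rewrite selected_rcons //= E.
  case: leP => // ht.
  by rewrite selected_gt ?chain_mono //= E.
split; rewrite ?size_rcons //.
move: hO hp; rewrite /is_chain /= !rcons_path /= => -> /andP[_ /andP[-> ->]].
by rewrite E.
Qed.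

(** Later appends see what precedes them only through its selected function and its last point.
    Skipping a repeated point preserves both. *)
Lemma emitteds_spec O s : is_chain O -> sorted mono (O ++ s) ->
  [/\ is_chain (foldl emitted O s),
      selected (foldl emitted O s) = selected (O ++ s),
      last (0, 0) (foldl emitted O s) = last (0, 0) (O ++ s),
      O ++ s != [::] -> foldl emitted O s != [::] &
      (size (foldl emitted O s) <= size O + size s)%N].
Proof.
elim: s O => [|p s IH] O hO; first by rewrite !cats0 /= addn0.
rewrite -cat_rcons => hs.
have hp : sorted mono (rcons O p) by move: hs => /cat_sorted2[].
have [h1 h2 h3 h4] := emitted_spec hO hp.
have l0 : emitted O p ++ s != [::] by case: emitted h3.
have hs' : sorted mono (emitted O p ++ s).
  case E : (emitted O p) h3 => [//|a O'] _.
  move: (chain_mono h1) (emitted_last (0, 0) O p); rewrite E /= cat_path.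
  move=> -> -> /=.
  by move: hs; rewrite cat_rcons sorted_cat_cons => /andP[].
have [k1 k2 k3 k4 k5] := IH _ h1 hs'.
split => //=; last by rewrite addnS -addSn (leq_trans k5) // leq_add2r.
- rewrite k2; apply/funext => t.
  elim/last_ind: s hs hs' {IH l0 k1 k2 k3 k4 k5} => [|s q IH].
    by rewrite !cats0 h2.
  rewrite -!rcons_cat => hs hs'.
  have n1 : rcons O p ++ s != [::] by case: (O).
  have n2 : emitted O p ++ s != [::] by case: emitted h3.
  have := hs; have := hs'; rewrite !sorted_mono_rcons //.
  move=> /andP[g1 _] /andP[g2 _].
  rewrite !selected_rcons // IH //.
  by rewrite !last_cat last_rcons emitted_last.
- by rewrite k3 !last_cat last_rcons emitted_last.
- by move=> _; exact: k4.
Qed.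

Lemma composite_emitteds F G O s : is_chain O -> composite F G (O ++ s) ->
  [/\ is_chain (foldl emitted O s), composite F G (foldl emitted O s) &
      (size (foldl emitted O s) <= size O + size s)%N].
Proof.
move=> hO [[F0 G0 O0] [sF sG sO] eFG eO sel_eq].
have [h1 h2 h3 h4 h5] := emitteds_spec hO sO.
split=> //; split; rewrite ?h2 ?h3 //; split=> //; first exact: h4.
exact: chain_mono.
Qed.

(** Beyond the last abscissa of [G], either [g] is undefined, or its values exceed the last abscissa
    of [F], where [f] ends. *)
Lemma composite_exhaustive F G O s s' : composite F G O ->
  sorted mono (F ++ s) -> sorted mono (G ++ s') ->
  all (fun q => (last (0, 0) G).2 < q.2) s' -> s = [::] \/ s' = [::] ->
  pcomp (selected (F ++ s)) (selected (G ++ s')) = selected O.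
Proof.
move=> [[F0 G0 O0] [sF sG sO] eFG eO ->] hF hG hs' hss.
apply/funext => t; rewrite /pcomp.
case: (leP t (last (0, 0) G).1) => ht.
  rewrite selected_cat //; case E : selected => [y|//] /=.
  have /and4P[_ _ _ hy] := selected_bounds G0 sG E.
  by rewrite selected_cat // eFG.
rewrite (selected_gt _ _ ht) //=.
case E : selected => [y|//] /=.
have hy := selected_gt_last G0 hG ht hs' E.
case: hss => h; subst; first by rewrite cats0 selected_gt // eFG.
by move: E; rewrite cats0 selected_gt.
Qed.

End Composite.

(** The measure [mu] also serves as a potential. An iteration lowers it by at least one, so its
    test, like its body, is charged to the decrease, whence the factor 2; the final test accounts
    for the [+ 1]. The bounds [M] and [N] are separate because the body may contain loops of its
    own. *)
Lemma while_loop_terminates (S : Type) (Inv : S -> Prop) (mu : S -> nat)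
    (N0 K : nat) (cond : S -> run bool) (body : nat -> S -> run S) :
  (forall s, Inv s -> exists b c,
    [/\ cond s = Some (b, c), (c <= K)%N &
      b -> exists s' d,
        [/\ forall N, (N0 <= N)%N -> body N s = Some (s', d), Inv s',
            (mu s' < mu s)%N & (d <= K * (mu s - mu s'))%N]]) ->
  forall s, Inv s -> exists s' c,
    [/\ forall M N, (mu s <= M)%N -> (N0 <= N)%N ->
          while_loop M cond (body N) s = Some (s', c),
        Inv s', exists c', cond s' = Some (false, c'), (mu s' <= mu s)%N &
        (c <= K * (2 * (mu s - mu s') + 1))%N].
Proof.
move=> step s; have [n] := ubnP (mu s).
elim: n s => // n IH s /ltnSE les Is.
have [[] [c [Ec cK]]] := step s Is; last first.
  move=> _; exists s, c; split => //.
  - by case=> [|M] N _ _ /=; rewrite Ec /= addn0.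
  - by exists c.
  - by rewrite subnn muln1.
move=> /(_ isT) [s1 [d [Eb I1 lt1 dK]]].
have [s' [c' [E' I' [c'' Ec''] le' c'K]]] := IH s1 (leq_trans lt1 les) I1.
exists s', (c + (d + c'))%N; split => //.
- case=> [|M] N hM hN; first by move: hM lt1; lia.
  rewrite /= Ec /= Eb // /= E' //.
  by rewrite -ltnS (leq_trans lt1).
- by exists c''.
- exact: leq_trans (ltnW lt1).
- by nia.
Qed.

(** * Execution of the algorithm *)

Section Algorithm.
Variable R : realFieldType.
Implicit Types (b F G O s : seq (R * R)) (p q r : R * R) (lo hi ev : R).

Lemma readE b1 p b2 : read (b1 ++ p :: b2) (size b1) = Some (p, 1%N).
Proof. by rewrite /read; elim: b1. Qed.

Lemma size_cat_lt b1 b2 : (size b1 < size (b1 ++ b2))%N = (b2 != [::]).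
Proof. by rewrite size_cat -{1}[size b1]addn0 ltn_add2l; case: b2. Qed.

(* [sw] is [false] for the scan of the chain of [f] by abscissa, and [true] for
   that of the chain of [g] by ordinate. *)
Section Coordinate.
Variable (sw : bool).
Let key : R * R -> R := if sw then snd else fst.
Let val : R * R -> R := if sw then fst else snd.
Let point (k v : R) : R * R := if sw then (v, k) else (k, v).

Lemma key_point k v : key (point k v) = k.
Proof. by rewrite /key /point; case: sw. Qed.

Lemma point_key_val p : point (key p) (val p) = p.
Proof. by rewrite /key /val /point; case: sw; case: p. Qed.

Lemma first_index_spec b lo : has (fun p => lo <= key p) b ->
  exists b1 b2 c, [/\ b = b1 ++ b2, b2 != [::], all (fun p => key p < lo) b1,
    lo <= key (head (0, 0) b2) &
    (forall N, (size b <= N)%N -> first_index key N b lo = Some (size b1, c)) /\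
    (c <= 6 * size b + 3)%N].
Proof.
move=> hb.
pose Inv i := exists b1 b2, [/\ b = b1 ++ b2, i = size b1, b2 != [::] &
  all (fun p => key p < lo) b1].
have W := @while_loop_terminates _ Inv (fun i => size b - i)%N 0 3
  (fun i => let* p := read b i in pay 1 (key p < lo))
  (fun=> fun i => pay 1 i.+1).
have {W} := W _ 0%N; case.
- move=> i [b1 [[|p b2] [Eb -> //= _ hall]]].
  rewrite Eb readE /=; exists (key p < lo), 2%N; split=> // lt_lo.
  exists (size b1).+1, 1%N; split=> //; last 2 first.
  + by rewrite size_cat /=; lia.
  + by rewrite size_cat /=; lia.
  exists (rcons b1 p), b2; rewrite cat_rcons size_rcons all_rcons lt_lo.
  (* The search cannot run off the chain: a point with key at least [lo] still lies ahead. *)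
  split=> //; case: b2 Eb => // Eb; move: hb; rewrite Eb has_cat /= orbF.
  rewrite leNgt lt_lo orbF => /hasP[q /(allP hall)].
  by rewrite ltNge => /negP.
- by exists [::], b; split=> //; case: (b) hb.
move=> i [c [Ew [b1 [[|p b2] [Eb Ei // _ hall]]] [c' Ec] _ hc]].
exists b1, (p :: b2), c; split=> //.
  by move: Ec; rewrite Ei Eb readE /= leNgt => -[->].
split; last by move: hc; lia.
by move=> N hN; rewrite /first_index (Ew N 0%N) ?Ei // subn0.
Qed.

Lemma collect_spec b1 b2 ev : exists c1 c2 c,
  [/\ b2 = c1 ++ c2, all (fun p => key p == ev) c1,
      c2 = [::] \/ key (head (0, 0) c2) != ev &
      (forall N, (size b2 <= N)%N -> collect key val N (b1 ++ b2) ev (size b1)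
        = Some ((size (b1 ++ c1), [seq val p | p <- c1]), c)) /\
      (c <= 6 * size c1 + 3)%N].
Proof.
set b := b1 ++ b2.
pose Inv (u : nat * seq R) := exists c1 c2,
  [/\ b2 = c1 ++ c2, all (fun p => key p == ev) c1 &
      u = (size (b1 ++ c1), [seq val p | p <- c1])].
have W := @while_loop_terminates _ Inv (fun u => size b - u.1)%N 0 3
    (fun s : nat * seq R =>
       let* c := pay 1 (s.1 < size b)%N in
       if c then let* p := read b s.1 in pay 1 (key p == ev) else pay 0 false)
    (fun=> fun s : nat * seq R =>
       let* p := read b s.1 in
       pay 2 (s.1.+1, rcons s.2 (val p))).
have {W} := W _ (size b1, [::]); case.
- move=> _ [c1 [c2 [Eb hall ->]]] /=.
  rewrite /b Eb catA size_cat_lt; case: c2 Eb => [|p c2] Eb /=.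
    by exists false, 1%N; split.
  rewrite readE /=; exists (key p == ev), 3%N; split=> // hp.
  exists ((size (b1 ++ c1)).+1, rcons [seq val p | p <- c1] (val p)), 3%N.
  split=> //; last 2 first.
  + by rewrite !size_cat /=; lia.
  + by rewrite !size_cat /=; lia.
  exists (rcons c1 p), c2; rewrite cat_rcons all_rcons hp map_rcons.
  by rewrite !size_cat size_rcons addnS.
- by exists [::], b2; rewrite cats0.
move=> u [c [Ew [c1 [c2 [Eb hall Eu]]] [c' Ec] _ hc]]; subst u.
exists c1, c2, c; split=> //.
- case: c2 Eb Ec => [|p c2] Eb; first by left.
  rewrite /b Eb catA size_cat_lt readE /= => -[h _]; right.
  by rewrite h.
- split; last by move: hc; rewrite /b Eb !size_cat /=; lia.
  move=> N hN; rewrite /collect (Ew N 0%N) //=.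
  by rewrite /b size_cat /=; lia.
Qed.

(* [F] is a prefix of a refinement of the chain [b1 ++ b2] of which [b1] has
   been scanned: its last point is the last scanned one or an interpolated one
   between that point and the next. *)
Definition at_edge F b1 b2 : Prop :=
  if b2 is q :: _ then
    exists b1' r, [/\ b1 = rcons b1' r, on_segment r (last (0, 0) F) q &
      key (last (0, 0) F) < key q]
  else key (last (0, 0) F) = key (last (0, 0) b1).

(** With nothing scanned there is no left neighbour to interpolate from, so the event must then fall
    on the first point of the chain. *)
Definition ready F b1 b2 ev : Prop :=
  (if b2 is q :: _ then ev <= key q else False) /\
  ((F = [::] /\ b1 = [::] /\ key (head (0, 0) b2) = ev) \/
   (F != [::] /\ at_edge F b1 b2 /\ key (last (0, 0) F) < ev)).

Lemma key_segment p r (l : R) :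
  key ((1 - l) * p.1 + l * r.1, (1 - l) * p.2 + l * r.2) =
  (1 - l) * key p + l * key r.
Proof. by rewrite /key; case: sw. Qed.

Lemma val_segment p r (l : R) :
  val ((1 - l) * p.1 + l * r.1, (1 - l) * p.2 + l * r.2) =
  (1 - l) * val p + l * val r.
Proof. by rewrite /val; case: sw. Qed.

Lemma on_segment_keyval p q r (l : R) : 0 <= l <= 1 ->
  key q = (1 - l) * key p + l * key r -> val q = (1 - l) * val p + l * val r ->
  on_segment p q r.
Proof.
move=> hl; rewrite /key /val => h1 h2; exists l => //.
by case: q h1 h2 => q1 q2; case: sw => /= -> ->.
Qed.

Lemma on_segment_refl p q : on_segment p p q.
Proof.
exists 0; first by rewrite lexx ler01.
by case: p => p1 p2 /=; rewrite subr0 !mul1r !mul0r !addr0.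
Qed.

(** The algorithm interpolates between the chain points [r] and [q], whereas the refined prefix ends
    at [p], possibly an earlier interpolated point. The first conclusion makes the insertion a
    refinement; the second restores [at_edge]. *)
Lemma on_segment_lerp r p q ev : on_segment r p q ->
  key p < ev -> ev < key q ->
  on_segment p
    (point ev (lerp (key r) (val r) (key q) (val q) ev)) q /\
  on_segment r
    (point ev (lerp (key r) (val r) (key q) (val q) ev)) q.
Proof.
move=> [l /andP[l0 l1] Ep] hp hq.
have Ekp : key p = (1 - l) * key r + l * key q by rewrite Ep key_segment.
have Evp : val p = (1 - l) * val r + l * val q by rewrite Ep val_segment.
have hrq : key r < key q by nra.
have Ev k v : val (point k v) = v by rewrite /val /point; case: sw.
split.
- apply: (@on_segment_keyval _ _ _ ((ev - key p) / (key q - key p))).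
  + by rewrite divr_ge0 ?ler_pdivrMr; lra.
  + by rewrite key_point; field; lra.
  + rewrite Ev /lerp Evp; rewrite Ekp in hp *; field.
    by apply/andP; split; nra.
- apply: (@on_segment_keyval _ _ _ ((ev - key r) / (key q - key r))).
  + by rewrite divr_ge0 ?ler_pdivrMr; nra.
  + by rewrite key_point; field; lra.
  + by rewrite Ev /lerp; field; lra.
Qed.
Lemma mono_key p q : mono p q -> key p <= key q.
Proof. by rewrite /key => /andP[h1 h2]; case: sw. Qed.

Lemma sorted_key_le p s q : sorted mono (p :: s) -> q \in p :: s ->
  key p <= key q.
Proof.
rewrite inE => hs /orP[/eqP->//|hq].
by apply: mono_key; exact: (allP (path_mono_ge hs)).
Qed.

(** One event seen from one chain. The bound with [maxn 1] covers both a collected list and the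
    interpolated singleton; the last numerical clause yields progress on the chain whose next key is
    the event. *)
Lemma advance F b1 b2 ev : sorted mono (b1 ++ b2) -> ready F b1 b2 ev ->
  exists c1 c2 v vs c l c',
  [/\ b2 = c1 ++ c2,
      (forall N, (size b2 <= N)%N -> collect key val N (b1 ++ b2) ev (size b1)
         = Some ((size (b1 ++ c1), l), c)),
      or_interpolate key val (b1 ++ b2) ev (size (b1 ++ c1)) l
         = Some (v :: vs, c'),
      [/\ (c + c' <= 6 * size c1 + 14)%N, (size vs < maxn 1 (size c1))%N &
        key (head (0, 0) b2) = ev -> (0 < size c1)%N] &
      let F1 := F ++ [seq point ev v' | v' <- v :: vs] in
      (sorted mono (F ++ b2) ->
        sorted mono (F1 ++ c2) /\ selected (F1 ++ c2) = selected (F ++ b2)) /\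
      at_edge F1 (b1 ++ c1) c2].
Proof.
move=> hs [hev hF].
have [c1 [c2 [c [Eb hall hc2 [Ec cK]]]]] := collect_spec b1 b2 ev.
case: c1 Eb hall Ec cK => [|p c1] Eb hall Ec cK.
- move: Eb; rewrite /= => Eb; subst c2.
  case: b2 hev hF hs hc2 Ec => [//|q b2] hev hF hs hc2 Ec.
  have {}hev : ev < key q.
    by rewrite lt_neqAle hev andbT eq_sym; case: hc2.
  case: hF => [[_ [_ /= Eq]]|[F0 [[b1' [r [Eb1 seg hq]]] hl]]].
    by move: hev; rewrite Eq ltxx.
  have hrq : mono r q.
    by move: hs; rewrite Eb1 cat_rcons => /cat_sorted2[_] /= /andP[].
  have /andP[hrp _] := on_segment_mono hrq seg.
  have hr : key r < ev by exact: le_lt_trans (mono_key hrp) hl.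
  set v := lerp (key r) (val r) (key q) (val q) ev.
  have [seg1 seg2] := on_segment_lerp seg hl hev.
  (* No chain point lies at [ev]. The interpolation costs 11, which with the 3 of a fruitless
     [collect] gives the constant 14. *)
  exists [::], (q :: b2), v, [::], c, [::], (1 + (1 + (1 + 7) + 1))%N.
  split => //.
  + rewrite cats0 /or_interpolate /= Eb1 size_rcons /interpolate.
    rewrite cat_rcons readE /= -cat_rcons -(size_rcons b1' r) readE /=.
    by rewrite hr hev.
  + split => //; first by move: cK => /=; lia.
    by move=> /= E; move: hev; rewrite E ltxx.
  + move=> /=; split; last first.
      exists b1', r; rewrite cats0 last_cat /= key_point; split => //.
    case/lastP: F {hrp} F0 hl seg hq seg1 => // F P _.
    rewrite !last_rcons => hl seg hq seg1.
    rewrite -catA !cat_rcons; apply: refine_cat; right.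
    by exists P, (point ev v), q, b2.
- exists (p :: c1), c2, (val p), [seq val p | p <- c1], c,
    [seq val p | p <- p :: c1], 1%N.
  have E1 : [seq point ev v' | v' <- val p :: [seq val p | p <- c1]] = p :: c1.
    rewrite -(map_cons val) -map_comp; apply: map_id_in => x /(allP hall).
    by move=> /eqP <-; exact: point_key_val.
  split => //.
  + split => //; first by move: cK => /=; lia.
    by rewrite size_map /=; lia.
  + rewrite E1; cbv zeta; rewrite -catA -Eb; split => //.
    have hlast : key (last p c1) = ev.
      by apply/eqP/(allP hall); exact: mem_last.
    rewrite /at_edge; case: c2 Eb hc2 => [|q c2] Eb hc2.
      by rewrite !last_cat.
    exists (b1 ++ belast p c1), (last p c1); rewrite last_cat /=.
    rewrite lastI rcons_cat; split => //; first exact: on_segment_refl.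
    rewrite hlast; case: hc2 => //= hq; rewrite lt_neqAle eq_sym hq /=.
    rewrite -hlast; apply: mono_key.
    have : sorted mono ((p :: c1) ++ q :: c2).
      by rewrite -Eb; move: hs => /cat_sorted2[].
    by rewrite /= cat_path => /andP[_ /= /andP[]].
Qed.

Lemma at_edge_gt F b1 b2 : sorted mono b2 -> at_edge F b1 b2 ->
  all (fun q => key (last (0, 0) F) < key q) b2.
Proof.
case: b2 => // q b2 hs [b1' [r [_ _ hq]]].
by apply/allP => x /(sorted_key_le hs); exact: lt_le_trans.
Qed.

Lemma within_spec b1 b2 hi : exists n,
  Defs.within key (b1 ++ b2) (size b1) hi =
    Some (if b2 is p :: _ then key p <= hi else false, n) /\ (n <= 3)%N.
Proof.
rewrite /Defs.within size_cat_lt; case: b2 => [|p b2] /=; first by exists 1%N.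
by rewrite readE /=; exists 3%N.
Qed.

Lemma availableE b1 p b2 :
  available key (b1 ++ p :: b2) (size b1) = Some (Some (key p), 2%N).
Proof. by rewrite /available size_cat_lt /= readE. Qed.

End Coordinate.

Lemma next_eventE (f1 f2 g1 g2 : seq (R * R)) : f2 != [::] -> g2 != [::] ->
  next_event (f1 ++ f2) (g1 ++ g2) (size f1) (size g1) =
  Some (Num.min (head (0, 0) f2).1 (head (0, 0) g2).2, 5%N).
Proof.
case: f2 => // p f2 _; case: g2 => // q g2 _.
by rewrite /next_event (availableE false) (availableE true).
Qed.

Lemma foreach_emit (A : Type) (h : A -> R * R) O (l : seq A) : exists c,
  foreach (fun o a => emit o (h a)) O l =
    Some (foldl (@emitted R) O [seq h a | a <- l], c) /\
  (c <= 6 * size l + 1)%N.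
Proof.
elim: l O => [|a l IH] O /=; first by exists 1%N.
have [d [Ed dK]] : exists d, emit O (h a) = Some (emitted O (h a), d) /\
    (d <= 5)%N.
  by rewrite /emit /emitted /=; case: O => [|q O] /=; [|case: ifP];
    eexists; split; try reflexivity.
have [c [Ec cK]] := IH (emitted O (h a)).
by rewrite Ed /= Ec; exists (1 + (d + c))%N; split => //; lia.
Qed.

Lemma in_chain_le_last (sw : bool) b1 p b2 : sorted mono (b1 ++ p :: b2) ->
  (if sw then snd else fst) p <=
  (if sw then snd else fst) (last (0, 0) (b1 ++ p :: b2)).
Proof.
move=> /cat_sorted2[_ hs]; rewrite last_cat /=.
apply: (sorted_key_le sw hs); exact: mem_last.
Qed.

End Algorithm.

(** * Invariant, progress and cost of the main loop *)

Section MainLoop.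
Variables (R : realFieldType) (bf bg : seq (R * R)) (lo hi : R).
Hypotheses (chain_f : is_chain bf) (chain_g : is_chain bg).
Hypotheses (hi_def : hi = Num.min (last (0, 0) bf).1 (last (0, 0) bg).2).

(** The first alternative holds after an event, the second before any. In the latter, the skipped
    points of [f] form [F]: the composition does not see them, but the last one is the left
    neighbour for interpolating [f] at [lo]. If none was skipped, the chain of [f] starts exactly at
    [lo]. *)
Definition main_inv (s : state R) : Prop := exists F G f1 f2 g1 g2,
  [/\ [/\ bf = f1 ++ f2, bg = g1 ++ g2, idx_f s = size f1 & idx_g s = size g1],
      [/\ sorted mono (F ++ f2), sorted mono (G ++ g2),
        selected (F ++ f2) = selected bf & selected (G ++ g2) = selected bg],
      is_chain (output s), (size (output s) <= idx_f s + idx_g s)%N &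
      [/\ composite F G (output s), at_edge false F f1 f2 &
        at_edge true G g1 g2] \/
      [/\ [/\ output s = [::], G = [::] & g1 = [::]],
        [/\ F = f1 & all (fun p => p.1 < lo) F],
        [/\ f2 != [::] & lo <= (head (0, 0) f2).1],
        [/\ g2 != [::] & (head (0, 0) g2).2 = lo] &
        f1 = [::] -> (head (0, 0) f2).1 = lo]].

Lemma ready_event F G f1 f2 g1 g2 O :
  f2 != [::] -> g2 != [::] ->
  [/\ composite F G O, at_edge false F f1 f2 & at_edge true G g1 g2] \/
  [/\ [/\ O = [::], G = [::] & g1 = [::]],
    [/\ F = f1 & all (fun p => p.1 < lo) F],
    [/\ f2 != [::] & lo <= (head (0, 0) f2).1],
    [/\ g2 != [::] & (head (0, 0) g2).2 = lo] &
    f1 = [::] -> (head (0, 0) f2).1 = lo] ->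
  let ev := Num.min (head (0, 0) f2).1 (head (0, 0) g2).2 in
  [/\ ready false F f1 f2 ev, ready true G g1 g2 ev & joinable F G O ev].
Proof.
case: f2 => // p f2 _; case: g2 => // q g2 _ /=.
case=> [[hc hf hg]|[[-> -> ->] [-> hall] [_ hp] [_ hq] h0]].
- have [[F0 G0 _] _ eFG _ _] := hc.
  have lt_ev : (last (0, 0) F).1 < Num.min p.1 q.2.
    case: (hf) => [_ [_ [_ _ /= l1]]]; case: (hg) => [_ [_ [_ _ /= l2]]].
    by rewrite lt_min l1 /= eFG.
  split; last by left.
  + by split; [rewrite ge_min lexx | right].
  + split; first by rewrite ge_min lexx orbT.
    by right; split=> //; split; rewrite //= -eFG.
- have -> : Num.min p.1 q.2 = lo by rewrite hq min_r.
  split; last by right.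
  + split => //.
    case/lastP: f1 h0 hall => [|f1 r] h0 hall; first by left; rewrite /= h0.
    right; rewrite rcons_neq0 /= last_rcons; split => //.
    have lt_r : r.1 < lo by move: hall; rewrite all_rcons => /andP[].
    split => //; exists f1, r; split => //.
      exact: on_segment_refl.
    exact: lt_le_trans hp.
  + by split; [rewrite /= hq | left].
Qed.

#[local] Arguments foreach : simpl never.

(** The constant 100 is generous: an event consuming [n >= 1] points costs at most [42 + 12 * n],
    and a test at most 6. *)
Lemma main_cond_spec (s : state R) : main_inv s -> exists (b : bool) c,
  [/\ main_cond bf bg hi s = Some (b, c), (c <= 100)%N &
    if b then exists (s' : state R) d,
      [/\ forall N, (size bf + size bg <= N)%N ->
          main_body N bf bg s = Some (s', d),
        main_inv s',
        (size bf - idx_f s' + (size bg - idx_g s') <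
         size bf - idx_f s + (size bg - idx_g s))%N &
        (d <= 100 * ((size bf - idx_f s + (size bg - idx_g s)) -
          (size bf - idx_f s' + (size bg - idx_g s'))))%N]
    else selected (output s) = pcomp (selected bf) (selected bg)].
Proof.
move=> [F [G [f1 [f2 [g1 [g2 [[Ef Eg Ei Ej] [sF sG eF eG] hO sO hcase]]]]]]].
have [n [En nK]] := within_spec false f1 f2 hi.
have [m [Em mK]] := within_spec true g1 g2 hi.
have sf : sorted mono (f1 ++ f2) by rewrite -Ef; exact: chain_mono.
have sg : sorted mono (g1 ++ g2) by rewrite -Eg; exact: chain_mono.
pose b := (if f2 is p :: _ then p.1 <= hi else false) ||
          (if g2 is p :: _ then p.2 <= hi else false).
have [c [Ec cK]] : exists c, main_cond bf bg hi s = Some (b, c) /\ (c <= 100)%N.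
  rewrite /main_cond Ef Ei Eg Ej En /b /=.
  case: (if f2 is p :: _ then _ else _) => /=.
    by exists (n + 0)%N; split => //; lia.
  by rewrite Em; exists (n + m)%N; split => //; lia.
exists b, c; split => //; rewrite {}/b in Ec *.
case: ifPn => hb; last first.
  (* If both chains had points left, both next keys would exceed [hi], although one of them is at
     most [hi], the smaller of the two last keys. *)
  have h0 : f2 = [::] \/ g2 = [::].
    case: (f2) (g2) hb Ef Eg sf sg => [|p f2'] [|q g2']; try by [left|right].
    move=> /norP[h1 h2] Ef' Eg' sf' sg'.
    have := in_chain_le_last false sf'; have := in_chain_le_last true sg'.
    rewrite -Ef' -Eg' /= => l1 l2; move: h1 h2.
    rewrite hi_def !le_min l2 l1 /= andbT -!ltNge => k1 k2.
    have := le_lt_trans l2 (lt_le_trans k2 (le_trans l1 (ltW k1))).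
    by rewrite ltxx.
  case: hcase => [[hc hf hg]|[_ _ [nf _] [ng _] _]]; last first.
    by case: h0 => h0; rewrite h0 in nf ng.
  rewrite -eF -eG (composite_exhaustive hc) //.
  by apply: (at_edge_gt _ hg); move: sg => /cat_sorted2[].
(* When one chain is exhausted, the shared coordinate is its last key, hence at least [hi]; the next
   key of the other chain is strictly larger, and the loop would have stopped. *)
have [f0 g0] : f2 != [::] /\ g2 != [::].
  case: hcase => [[hc hf hg]|[_ _ [nf _] [ng _] _]] //.
  have [_ _ eFG _ _] := hc.
  case: (f2) (g2) hb hf hg Ef Eg => [|p f2'] [|q g2'] //=.
  + rewrite /= => hq hf [_ [_ [_ _ hl]]] Ef' Eg'.
    move: hq hl; rewrite -eFG /= hf hi_def le_min Ef' cats0 => /andP[h1 _] h2.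
    by move: (le_lt_trans h1 h2); rewrite ltxx.
  + rewrite orbF => hp [_ [_ [_ _ hl]]] hg Ef' Eg'.
    move: hp hl; rewrite /= eFG hg hi_def le_min Eg' cats0 => /andP[_ h1] h2.
    by move: (le_lt_trans h1 h2); rewrite ltxx.
have /= := ready_event f0 g0 hcase; set ev := Num.min _ _ => -[rf rg hj].
have [cf1 [cf2 [y [ys [cf [lf [cf' [Ef2 colf intf Kf [reff atf]]]]]]]]] :=
  advance sf rf.
have [kf zf wf] := Kf.
have [cg1 [cg2 [t [ts [cg [lg [cg' [Eg2 colg intg Kg [refg atg]]]]]]]]] :=
  advance sg rg.
have [kg zg wg] := Kg.
have [hsF hselF] := reff sF; have [hsG hselG] := refg sG.
have sF' : sorted mono (F ++ [seq (ev, y') | y' <- y :: ys]).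
  by move: hsF => /cat_sorted2[].
have sG' : sorted mono (G ++ [seq (t', ev) | t' <- t :: ts]).
  by move: hsG => /cat_sorted2[].
have hc := composite_event hj sF' sG'.
have [kO1 kO2 kO3] := composite_emitteds hO hc.
have [d1 [Ed1 d1K]] := foreach_emit (fun t => (t, y)) (output s) (t :: ts).
have [d2 [Ed2 d2K]] := foreach_emit (fun y => (last t ts, y))
  (foldl (@emitted R) (output s) [seq (t, y) | t <- t :: ts]) ys.
(* The chain that attains the minimum advances. *)
have adv : (0 < size cf1 + size cg1)%N.
  rewrite addn_gt0; apply/orP.
  case: (leP (head (0, 0) f2).1 (head (0, 0) g2).2) => h.
    by left; apply: wf; rewrite /ev min_l.
  by right; apply: wg; rewrite /ev min_r // ltW.
pose O' := foldl (@emitted R) (output s) (merged (y :: ys) (t :: ts)).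
exists (State (size (f1 ++ cf1)) (size (g1 ++ cg1)) O').
exists (5 + (cf + (cg + (cf' + (cg' + (d1 + (1 + (d2 + 0))))))))%N.
split => /=.
- move=> N hN; rewrite /main_body.
  rewrite Ei Ej Ef Eg next_eventE //= colf; last first.
    by apply: leq_trans hN; rewrite Ef size_cat -addnA addnCA leq_addr.
  rewrite /= colg; last first.
    by apply: leq_trans hN; rewrite Eg size_cat addnA leq_addl.
  by rewrite /= intf /= intg /= Ed1 /= Ed2 /= -foldl_cat.
- exists (F ++ [seq (ev, y') | y' <- y :: ys]).
  exists (G ++ [seq (t', ev) | t' <- t :: ts]).
  exists (f1 ++ cf1), cf2, (g1 ++ cg1), cg2.
  split => //=.
  + by rewrite -!catA -Ef2 -Eg2.
  + split => //; [exact: etrans hselF eF | exact: etrans hselG eG].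
  (* [adv] absorbs the point emitted beyond the consumed ones when one list is interpolated. Skipped
     points of [f] are counted in [idx_f]. *)
  + apply: (leq_trans kO3).
    rewrite /merged /= !size_cat /= !size_map.
    by move: zf zg sO adv; rewrite Ei Ej; clear; lia.
  + by left.
- rewrite Ei Ej Ef Eg Ef2 Eg2 !size_cat.
  by move: adv; clear; lia.
- rewrite Ei Ej Ef Eg Ef2 Eg2 !size_cat.
  by move: d1K d2K zf zg kf kg adv => /=; clear; lia.
Qed.
End MainLoop.

(** By the last hypothesis the index search on [g] stops at once ([g10]), so the whole chain of [g]
    is swept. *)
Lemma compose_spec (R : realFieldType) (bf bg : seq (R * R)) :
  is_chain bf -> is_chain bg -> bf != [::] -> bg != [::] ->
  (head (0, 0) bf).1 <= (head (0, 0) bg).2 ->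
  exists bh c,
  [/\ compose_returns bf bg bh c, (c <= 1000 * (size bf + size bg))%N,
      is_chain bh, selected bh = pcomp (selected bf) (selected bg) &
      (size bh <= size bf + size bg)%N].
Proof.
move=> cf cg nf ng hfg.
have sf := chain_mono cf; have sg := chain_mono cg.
have sz : (0 < size bf + size bg)%N.
  by rewrite addn_gt0 lt0n size_eq0 nf.
set lo := (head (0, 0) bg).2.
pose hi := Num.min (last (0, 0) bf).1 (last (0, 0) bg).2.
have read0 b : b != [::] -> read b 0 = Some (head ((0, 0) : R * R) b, 1%N).
  by case: b.
have readl b : b != [::] ->
    read b (size b).-1 = Some (last ((0, 0) : R * R) b, 1%N).
  case/lastP: b => // b p _.
  by rewrite size_rcons -cats1 last_cat /= readE.
have lo_g : lo <= (last (0, 0) bg).2.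
  rewrite /lo; case: (bg) ng sg => // p s _ /= /path_mono_ge/allP h.
  by have := mem_last p s; rewrite inE => /orP[/eqP->|/h/andP[]].
have compE N : compose_upto N bf bg =
    let* _ := pay 9 tt in
    if hi < lo then pay 0 [::] else
    let* i := first_index fst N bf lo in
    let* j := first_index snd N bg lo in
    let* s := while_loop N (main_cond bf bg hi) (main_body N bf bg)
                (State i j [::]) in
    pay 0 (output s).
  rewrite /compose_upto !size_eq0 (negbTE nf) (negbTE ng) /=.
  rewrite !read0 // !readl //= (max_idPr hfg) -/lo -/hi.
  by case: (if hi < lo then _ else _) => [[]|].
have [lt_hi|le_lo] := ltP hi lo.
  (* Since [lo] is at most the last ordinate of [g], here [f] ends before [lo], below all values of
     [g]. *)
  exists [::], 9%N; split => //.
  - by exists 0%N => N _; rewrite compE /= lt_hi.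
  - by clear -sz; lia.
  - apply/funext => t; rewrite /pcomp.
    case E : (selected bg t) => [y|//] /=.
    have /and4P[_ _ hy _] := selected_bounds ng sg E.
    rewrite [RHS]selected_gt //; apply: lt_le_trans hy.
    move: lt_hi; rewrite /hi gt_min.
    by case/orP=> [|/(le_lt_trans lo_g)]; rewrite ?ltxx.
have hasf : has (fun p : R * R => lo <= p.1) bf.
  apply/hasP; exists (last (0, 0) bf).
    by case: (bf) nf => // p s _; rewrite /= mem_last.
  by move: le_lo; rewrite le_min => /andP[].
have hasg : has (fun p : R * R => lo <= p.2) bg.
  apply/hasP; exists (last (0, 0) bg) => //.
  by case: (bg) ng => // p s _; rewrite /= mem_last.
have [f1 [f2 [cf1 [Ef nf2 hf1 hf2 [Wf cf1K]]]]] :=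
  @first_index_spec R false bf lo hasf.
have [g1 [g2 [cg1 [Eg ng2 hg1 hg2 [Wg cg1K]]]]] :=
  @first_index_spec R true bg lo hasg.
have g10 : g1 = [::].
  case: g1 Eg hg1 {Wg} => // q g1 Eg /= /andP[+ _].
  by rewrite /lo Eg /= ltxx.
subst g1; rewrite /= in Eg Wg cg1K.
have Inv0 : main_inv bf bg lo (State (size f1) 0 [::]).
  exists f1, [::], f1, f2, [::], g2; split => //=.
  - by rewrite -Ef -Eg.
  - right; split => //; first by split => //; rewrite /lo Eg.
    move=> f10; apply/eqP; rewrite eq_le hf2 andbT.
    by move: hfg; rewrite Ef f10.
have [] := @while_loop_terminates _ (main_inv bf bg lo)
  (fun s => size bf - idx_f s + (size bg - idx_g s))%N (size bf + size bg) 100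
  (main_cond bf bg hi) (fun N => main_body N bf bg) _ _ Inv0.
- move=> s Is; have [b [c [Ec cK hb]]] := main_cond_spec cf cg erefl Is.
  by exists b, c; split => // bT; rewrite bT in hb.
move=> s [c [Ew Is [c' Ec'] _ cK]].
have [b [c'' [Ec'' _]]] := main_cond_spec cf cg erefl Is.
rewrite Ec' in Ec''; case: Ec'' => <- _ hsel.
case: Is => [F [G [f1' [f2' [g1' [g2' [[Ef' Eg' Ei Ej] _ hO sO _]]]]]]].
(* With [S] the total size of the two chains, the cost is at most
   [9 + (6 * S + 6) + 100 * (2 * S + 1)], hence below [1000 * S] as [S > 0]. *)
exists (output s), (9 + (cf1 + (cg1 + (c + 0))))%N; split => //.
- exists (size bf + size bg)%N => N hN; rewrite compE /= ltNge le_lo /=.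
  rewrite Wf /=; last by apply: leq_trans hN; exact: leq_addr.
  rewrite Wg /=; last by apply: leq_trans hN; exact: leq_addl.
  by rewrite Ew //=; apply: leq_trans hN; rewrite leq_add ?leq_subr.
- by move: cK sz cf1K cg1K => /=; clear; nia.
- apply: (leq_trans sO); rewrite Ei Ej Ef' Eg' !size_cat.
  by clear; lia.
Qed.

(** * Canonical chains *)

Section Canonical.
Variable R : realType.
Implicit Types (b s : seq (R * R)) (p q c d v w P : R * R) (t : R) (h : pfun R).
Local Open Scope classical_set_scope.

Let slope c d : R := (d.2 - c.2) / (d.1 - c.1).

Lemma lerpE c d t :
  lerp c.1 c.2 d.1 d.2 t = slope c d * t + (c.2 - slope c d * c.1).
Proof. by rewrite /lerp /slope; ring. Qed.

(** A discrete intermediate value theorem, used to locate the edge over a given abscissa. *)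
Lemma switch (T : Type) (A : pred T) x (s : seq T) : A x -> ~~ A (last x s) ->
  exists (s1 : seq T) y z (s2 : seq T),
    [/\ x :: s = s1 ++ y :: z :: s2, A y & ~~ A z].
Proof.
elim: s x => [|y s IH] x /=; first by move=> ->.
move=> Ax; case Ay : (A y).
  move=> /(IH _ Ay)[s1 [y' [z [s2 [-> hy hz]]]]].
  by exists (x :: s1), y', z, s2.
by move=> _; exists [::], x, y, s; rewrite Ay.
Qed.

(** The half-open conditions exclude vertical edges. This edge gives the value and the behaviour on
    the left of [t]; the one of [right_edge] gives the right limit and the behaviour on the
    right. *)
Lemma left_edge b t : b != [::] ->
  (head (0, 0) b).1 < t -> t <= (last (0, 0) b).1 ->
  exists s1 c d s2, [/\ b = s1 ++ c :: d :: s2, c.1 < t & t <= d.1].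
Proof.
case: b => // p s _ /= h1 h2.
have [|s1 [c [d [s2 [-> hc hd]]]]] := @switch _ (fun q => q.1 < t) p s h1.
  by rewrite -leNgt.
by exists s1, c, d, s2; rewrite leNgt.
Qed.

Lemma right_edge b t : b != [::] ->
  (head (0, 0) b).1 <= t -> t < (last (0, 0) b).1 ->
  exists s1 c d s2, [/\ b = s1 ++ c :: d :: s2, c.1 <= t & t < d.1].
Proof.
case: b => // p s _ /= h1 h2.
have [|s1 [c [d [s2 [-> hc hd]]]]] := @switch _ (fun q => q.1 <= t) p s h1.
  by rewrite -ltNge.
by exists s1, c, d, s2; rewrite ltNge.
Qed.

Lemma selected_edge b s1 c d s2 t : sorted mono b -> b = s1 ++ c :: d :: s2 ->
  c.1 < t -> t <= d.1 -> selected b t = Some (lerp c.1 c.2 d.1 d.2 t).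
Proof.
move=> hs Eb ct td; rewrite Eb -!cat_rcons in hs *.
rewrite selected_cat ?rcons_neq0 ?last_rcons //.
have {}hs : sorted mono (rcons (rcons s1 c) d) by case: (cat_sorted2 hs).
by rewrite selected_rcons ?rcons_neq0 // last_rcons leNgt ct td.
Qed.

Lemma sorted_mono_split s1 c d s2 w : sorted mono (s1 ++ c :: d :: s2) ->
  w \in s1 ++ c :: d :: s2 -> mono w c \/ mono d w.
Proof.
move=> hs; rewrite mem_cat inE => /or3P[hw|/eqP->|hw].
- left; move: hs; rewrite -cat_rcons => /cat_sorted2[hs _].
  have := hs; rewrite (sorted_pairwise (@mono_trans R)) -cats1 pairwise_cat.
  by move=> /and3P[/allrelP/(_ w c hw) + _ _]; rewrite inE eqxx => /(_ isT).
- by left; rewrite mono_refl.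
- right; move: hs => /cat_sorted2[_ /= /andP[_ /path_mono_ge/allP hd]].
  by move: hw; rewrite inE => /orP[/eqP->|/hd//]; rewrite mono_refl.
Qed.

Lemma split_mono s1 c d s2 : sorted mono (s1 ++ c :: d :: s2) -> mono c d.
Proof. by move=> /cat_sorted2[_ /= /andP[]]. Qed.

Lemma selected_isSome b t : b != [::] -> sorted mono b ->
  isSome (selected b t) = ((head (0, 0) b).1 <= t <= (last (0, 0) b).1).
Proof.
move=> nb hs; apply/idP/idP.
  case E : selected => [y|//] _.
  by have /and4P[-> ->] := selected_bounds nb hs E.
move=> /andP[]; rewrite le_eqVlt => /orP[/eqP <- _|h1 h2].
  by case: b nb hs => // p s _ hs; rewrite selected_sel // sel_head.
have [s1 [c [d [s2 [Eb ct td]]]]] := left_edge nb h1 h2.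
by rewrite (selected_edge hs Eb).
Qed.

Lemma selected_head b : b != [::] -> sorted mono b ->
  selected b (head (0, 0) b).1 = Some (head (0, 0) b).2.
Proof. by case: b => // p s _ hs; rewrite selected_sel // sel_head. Qed.

Lemma affine_eq (m1 e1 m2 e2 x y : R) : x != y ->
  m1 * x + e1 = m2 * x + e2 -> m1 * y + e1 = m2 * y + e2 -> m1 = m2.
Proof.
move=> xy h1 h2; apply/eqP; rewrite -subr_eq0.
have : (m1 - m2) * (x - y) == 0 by apply/eqP; lra.
by rewrite mulf_eq0 (subr_eq0 x) (negbTE xy) orbF.
Qed.

(** Two affine maps equal to [h] near [t] agree at two distinct points. The slopes in
    [changes_slope] can thus be identified with those of the adjacent edges. *)
Lemma slope_along_left_unique h t m1 m2 :
  slope_along t^'- h m1 -> slope_along t^'- h m2 -> m1 = m2.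
Proof.
move=> [e1 h1] [e2 h2].
have [x [xt E1]] : exists x, x < t /\ m1 * x + e1 = m2 * x + e2.
  apply: (@filter_ex _ t^'-); near=> x; split.
    by near: x; exact: nbhs_left_lt.
  have <- : pval h x = m1 * x + e1 by near: x.
  by near: x.
have [y [xy E2]] : exists y, x < y /\ m1 * y + e1 = m2 * y + e2.
  apply: (@filter_ex _ t^'-); near=> y; split.
    by near: y; exact: nbhs_left_gt.
  have <- : pval h y = m1 * y + e1 by near: y.
  by near: y.
by apply: affine_eq E1 E2; rewrite lt_eqF.
Unshelve. all: by end_near. Qed.

Lemma slope_along_right_unique h t m1 m2 :
  slope_along t^'+ h m1 -> slope_along t^'+ h m2 -> m1 = m2.
Proof.
move=> [e1 h1] [e2 h2].
have [x [tx E1]] : exists x, t < x /\ m1 * x + e1 = m2 * x + e2.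
  apply: (@filter_ex _ t^'+); near=> x; split.
    by near: x; exact: nbhs_right_gt.
  have <- : pval h x = m1 * x + e1 by near: x.
  by near: x.
have [y [yx E2]] : exists y, y < x /\ m1 * y + e1 = m2 * y + e2.
  apply: (@filter_ex _ t^'+); near=> y; split.
    by near: y; exact: nbhs_right_lt.
  have <- : pval h y = m1 * y + e1 by near: y.
  by near: y.
by apply: affine_eq E1 E2; rewrite gt_eqF.
Unshelve. all: by end_near. Qed.

Lemma consecutive_ge (x : R) (r : seq R) e : path <%R x r ->
  e \in consecutive (x :: r) -> x <= e.1.
Proof.
elim: r x => // y r IH x /= /andP[xy hr].
rewrite inE => /orP[/eqP->//|/(IH _ hr)]; exact: le_trans (ltW xy).
Qed.

Lemma sel_piecewise p s : path mono p s -> exists r : seq R,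
  [/\ path <%R p.1 r, last p.1 r = (last p s).1 &
    forall e, e \in consecutive (p.1 :: r) ->
      exists m e' : R, forall t, e.1 < t < e.2 ->
        pval (sel p s) t = m * t + e'].
Proof.
elim: s p => [|q s IH] p /=; first by move=> _; exists [::]; split.
move=> /andP[/andP[pq1 _] /IH[r [hr hl hp]]].
have tail e : e \in consecutive (q.1 :: r) -> exists m e' : R, forall t,
    e.1 < t < e.2 -> pval (sel p (q :: s)) t = m * t + e'.
  move=> he; have [m [e' hm]] := hp e he; exists m, e' => t ht.
  rewrite -hm // /pval /=; have /andP[et _] := ht.
  have qt : q.1 < t := le_lt_trans (consecutive_ge hr he) et.
  by rewrite leNgt (le_lt_trans pq1 qt) ltNge (ltW qt).
(* A vertical edge contributes no piece, since the cuts must increase strictly. *)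
move: pq1; rewrite le_eqVlt => /orP[/eqP E|pq].
  by exists r; split; [rewrite E|rewrite E|move=> e; rewrite {1}E; exact: tail].
exists (q.1 :: r); rewrite /= pq; split => // e.
rewrite inE => /orP[/eqP->|]; last exact: tail.
exists (slope p q), (p.2 - slope p q * p.1) => t /= /andP[pt tq].
by rewrite /pval /= leNgt pt tq /= lerpE.
Qed.

(** * Vertices of a chain and cuts of its function *)

Section Selected.
Variable b : seq (R * R).
Hypotheses (nb : b != [::]) (hs : sorted mono b).
Let h : pfun R := selected b.
Let a := (head (0, 0) b).1.
Let u := (last (0, 0) b).1.

Lemma pval_edge s1 c d s2 t : b = s1 ++ c :: d :: s2 ->
  c.1 < t -> t <= d.1 -> pval h t = lerp c.1 c.2 d.1 d.2 t.
Proof. by move=> Eb ct td; rewrite /pval /h (selected_edge hs Eb). Qed.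

Lemma pval_head : pval h a = (head (0, 0) b).2.
Proof. by rewrite /pval /h selected_head. Qed.

Lemma piecewise_selected : piecewise_affine h a u.
Proof.
rewrite /h /a /u; case: b nb hs => // p s _ hp.
by rewrite selectedE //; exact: sel_piecewise.
Qed.

Lemma near_left_edge s1 c d s2 t : b = s1 ++ c :: d :: s2 ->
  c.1 < t -> t <= d.1 ->
  \forall x \near t^'-, pval h x = lerp c.1 c.2 d.1 d.2 x.
Proof.
move=> Eb ct td; near=> x; apply: (pval_edge Eb).
  by near: x; exact: nbhs_left_gt.
by apply: le_trans td; near: x; exact: nbhs_left_le.
Unshelve. all: by end_near. Qed.

Lemma near_right_edge s1 c d s2 t : b = s1 ++ c :: d :: s2 ->
  c.1 <= t -> t < d.1 ->
  \forall x \near t^'+, pval h x = lerp c.1 c.2 d.1 d.2 x.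
Proof.
move=> Eb ct td; near=> x; apply: (pval_edge Eb).
  by apply: (le_lt_trans ct); near: x; exact: nbhs_right_gt.
by near: x; exact: nbhs_right_le.
Unshelve. all: by end_near. Qed.

Lemma lerp_continuous c d : continuous (fun x : R => lerp c.1 c.2 d.1 d.2 x).
Proof.
have -> : (fun x : R => lerp c.1 c.2 d.1 d.2 x) =
    (fun x : R => slope c d * x + (c.2 - slope c d * c.1)).
  by apply/funext => x; rewrite lerpE.
move=> t; apply: cvgD; last exact: cvg_cst.
by apply: cvgM; [exact: cvg_cst | exact: cvg_id].
Qed.

Lemma pval_left_continuous t : a < t <= u ->
  pval h x @[x --> t^'-] --> pval h t.
Proof.
move=> /andP[at_ tu].
have [s1 [c [d [s2 [Eb ct td]]]]] := left_edge nb at_ tu.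
rewrite (pval_edge Eb) //.
apply: cvg_trans; first by apply: near_eq_cvg; near=> x; symmetry;
  near: x; exact: (near_left_edge Eb).
by apply: cvg_at_left_filter; exact: lerp_continuous.
Unshelve. all: by end_near. Qed.

Lemma rlim_edge s1 c d s2 t : b = s1 ++ c :: d :: s2 ->
  c.1 <= t -> t < d.1 -> rlim h t = lerp c.1 c.2 d.1 d.2 t.
Proof.
move=> Eb ct td; apply: cvg_lim => //.
apply: cvg_trans; first by apply: near_eq_cvg; near=> x; symmetry;
  near: x; exact: (near_right_edge Eb).
by apply: cvg_at_right_filter; exact: lerp_continuous.
Unshelve. all: by end_near. Qed.

Lemma slope_left_edge s1 c d s2 t : b = s1 ++ c :: d :: s2 ->
  c.1 < t -> t <= d.1 -> slope_along t^'- h (slope c d).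
Proof.
move=> Eb ct td; exists (c.2 - slope c d * c.1).
near=> x; rewrite -lerpE; near: x; exact: (near_left_edge Eb).
Unshelve. all: by end_near. Qed.

Lemma slope_right_edge s1 c d s2 t : b = s1 ++ c :: d :: s2 ->
  c.1 <= t -> t < d.1 -> slope_along t^'+ h (slope c d).
Proof.
move=> Eb ct td; exists (c.2 - slope c d * c.1).
near=> x; rewrite -lerpE; near: x; exact: (near_right_edge Eb).
Unshelve. all: by end_near. Qed.

Lemma pval_prefix s1 c s2 t : b = s1 ++ c :: s2 -> a <= t -> t <= c.1 ->
  pval h t <= c.2.
Proof.
move=> Eb at_ tc; have hsc := hs; rewrite Eb -cat_rcons in hsc.
have Eh : h t = selected (rcons s1 c) t.
  by rewrite /h Eb -cat_rcons selected_cat ?rcons_neq0 ?last_rcons.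
have : isSome (selected (rcons s1 c) t).
  rewrite selected_isSome ?rcons_neq0 ?last_rcons ?tc ?andbT //.
    by move: at_; rewrite /a Eb -cat_rcons; case: (s1).
  by case: (cat_sorted2 hsc).
case E : selected => [y|//] _; rewrite /pval Eh E /=.
have [hsp _] := cat_sorted2 hsc.
have /and4P[_ _ _] := selected_bounds (rcons_neq0 _ _) hsp E.
by rewrite last_rcons.
Qed.

Lemma pval_nondecreasing x y : a <= x -> x <= y -> y <= u ->
  pval h x <= pval h y.
Proof.
move=> ax; rewrite le_eqVlt => /orP[/eqP->//|xy] yu.
have [s1 [c [d [s2 [Eb cy yd]]]]] := left_edge nb (le_lt_trans ax xy) yu.
have /andP[_ cd] : mono c d by apply: (@split_mono s1 _ _ s2); rewrite -Eb.
have lt_cd : c.1 < d.1 by exact: lt_le_trans yd.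
rewrite (pval_edge Eb cy yd).
have [xc|cx] := leP x c.1; last first.
  by rewrite (pval_edge Eb cx (le_trans (ltW xy) yd)) le_lerp // ltW.
apply: (le_trans (pval_prefix Eb ax xc)).
have /andP[-> //] : c.2 <= lerp c.1 c.2 d.1 d.2 y <= d.2.
by apply: lerp_bounds => //; rewrite (ltW cy).
Qed.

Lemma mem_last_b : last (0, 0) b \in b.
Proof. by case: b nb => // p s _; rewrite /= mem_last. Qed.

Lemma mono_head w : w \in b -> mono (head (0, 0) b) w.
Proof.
case: b hs => // p s /= /path_mono_ge/allP hp; rewrite inE.
by move=> /orP[/eqP->|/hp//]; exact: mono_refl.
Qed.

Lemma mono_last w : w \in b -> mono w (last (0, 0) b).
Proof.
case/lastP: b hs => // s p; rewrite last_rcons mem_rcons inE.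
rewrite (sorted_pairwise (@mono_trans R)) -cats1 pairwise_cat.
move=> /and3P[/allrelP h0 _ _] /orP[/eqP->|hw]; first exact: mono_refl.
by apply: h0 => //; rewrite inE.
Qed.

Lemma rlim_ge w : w \in b -> w.1 < u -> w.2 <= rlim h w.1.
Proof.
move=> hw wu; have /andP[aw _] := mono_head hw.
have [s1 [c [d [s2 [Eb cw wd]]]]] := right_edge nb aw wu.
rewrite (rlim_edge Eb cw wd).
have hsc := hs; rewrite Eb in hsc.
have /andP[_ cd] := split_mono hsc.
have lt_cd : c.1 < d.1 by exact: le_lt_trans wd.
have /andP[hc _] : c.2 <= lerp c.1 c.2 d.1 d.2 w.1 <= d.2.
  by apply: lerp_bounds => //; rewrite cw (ltW wd).
rewrite Eb in hw; case: (sorted_mono_split hsc hw) => /andP[h1 h2].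
  exact: le_trans hc.
by move: wd; rewrite ltNge h1.
Qed.

(** It depends on [b] only through the selected function and its domain, so chains of the same
    function share these points. *)
Definition canonical_vertex P : Prop :=
  is_cut h a u P.1 /\
  (P.2 = pval h P.1 \/ (jumps h u P.1 /\ P.2 = rlim h P.1)).

(** Strictly between the abscissae of an edge the function is continuous, with the same slope on
    both sides. *)
Lemma cut_abscissa t : is_cut h a u t -> exists2 w, w \in b & w.1 = t.
Proof.
move=> [/andP[at_ tu]]; have [->|ta] := eqVneq t a.
  move=> _; exists (head (0, 0) b) => //.
  by case: b nb => // p s _; exact: mem_head.
have [->|tu'] := eqVneq t u.
  by move=> _; exists (last (0, 0) b) => //; exact: mem_last_b.
have {}ta : a < t by rewrite lt_neqAle eq_sym ta.
have {}tu' : t < u by rewrite lt_neqAle tu'.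
have [s1 [c [d [s2 [Eb ct]]]]] := left_edge nb ta tu.
rewrite le_eqVlt => /orP[/eqP td _|td].
  by exists d => //; rewrite Eb mem_cat !inE eqxx !orbT.
case=> [E|E|/andP[_]|[_ [m1 [m2 [sl1 sl2 ne]]]]].
- by rewrite E ltxx in ta.
- by rewrite E ltxx in tu'.
- by rewrite (rlim_edge Eb (ltW ct) td) (pval_edge Eb ct (ltW td)) ltxx.
- exfalso; apply: ne.
  rewrite (slope_along_left_unique sl1 (slope_left_edge Eb ct (ltW td))).
  by rewrite (slope_along_right_unique sl2 (slope_right_edge Eb (ltW ct) td)).
Qed.

Lemma value_vertex w : w \in b -> (w.1, pval h w.1) \in b.
Proof.
move=> hw; have /andP[] := mono_head hw.
rewrite le_eqVlt => /orP[/eqP <- _|aw _].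
  rewrite pval_head; case: b nb => // p s _ /=.
  by rewrite -surjective_pairing mem_head.
have /andP[wu _] := mono_last hw.
have [s1 [c [d [s2 [Eb cw wd]]]]] := left_edge nb aw wu.
have hsc := hs; rewrite Eb in hsc.
rewrite (pval_edge Eb cw wd); rewrite Eb in hw.
case: (sorted_mono_split hsc hw) => /andP[h1 h2].
  by move: cw; rewrite ltNge h1.
have -> : w.1 = d.1 by apply/eqP; rewrite eq_le wd h1.
rewrite lerp_right; last by exact: lt_le_trans wd.
by rewrite -surjective_pairing Eb mem_cat !inE eqxx !orbT.
Qed.

Lemma rlim_vertex w : w \in b -> w.1 < u -> (w.1, rlim h w.1) \in b.
Proof.
move=> hw wu; have /andP[aw _] := mono_head hw.
have [s1 [c [d [s2 [Eb cw wd]]]]] := right_edge nb aw wu.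
have hsc := hs; rewrite Eb in hsc.
rewrite (rlim_edge Eb cw wd); rewrite Eb in hw.
case: (sorted_mono_split hsc hw) => /andP[h1 h2]; last first.
  by move: wd; rewrite ltNge h1.
have -> : w.1 = c.1 by apply/eqP; rewrite eq_le cw h1.
by rewrite lerp_left -surjective_pairing Eb mem_cat !inE eqxx !orbT.
Qed.

Lemma canonical_vertex_mem P : canonical_vertex P -> P \in b.
Proof.
case: P => t y [/cut_abscissa/= [w hw <-]] [->|[/andP[wu _] ->]].
  exact: value_vertex.
exact: rlim_vertex.
Qed.

Lemma vertex_at s1 v s2 : b = s1 ++ v :: s2 -> vertex b (size s1) = v.
Proof. by rewrite /vertex => ->; rewrite nth_cat ltnn subnn. Qed.

Lemma redundant_at s1 p v q s2 : b = rcons s1 p ++ v :: q :: s2 ->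
  redundant b (size (rcons s1 p)) = `[< on_segment p v q >].
Proof.
move=> Eb; rewrite /redundant (vertex_at Eb).
have -> : vertex b (size (rcons s1 p)).-1 = p.
  rewrite size_rcons /=; apply: (@vertex_at s1 p (v :: q :: s2)).
  by rewrite Eb cat_rcons.
have -> : vertex b (size (rcons s1 p)).+1 = q.
  rewrite -(size_rcons _ v); apply: (@vertex_at _ q s2).
  by rewrite Eb -!cat_rcons.
rewrite size_rcons Eb size_cat size_rcons /=.
by have -> : ((size s1).+2 < (size s1).+1 + (size s2).+2)%N by clear; lia.
Qed.

Lemma trailing_at s1 v s2 : b = s1 ++ v :: s2 ->
  trailing b (size s1) =
  (v.1 == u) && has (fun p => (p.1 == v.1) && (p.2 < v.2)) b.
Proof.
move=> Eb; rewrite /trailing (vertex_at Eb) /u /vertex.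
by rewrite (last_nth (0, 0)) /=; case: b nb.
Qed.

Lemma on_segment_slope p v q : p.1 < v.1 -> v.1 < q.1 ->
  on_segment p v q <-> slope p v = slope v q.
Proof.
case: p => p1 p2; case: v => v1 v2; case: q => q1 q2 /= pv vq.
have d1 : v1 - p1 != 0 by rewrite subr_eq0 gt_eqF.
have d2 : q1 - v1 != 0 by rewrite subr_eq0 gt_eqF.
have d3 : q1 - p1 != 0 by rewrite subr_eq0 gt_eqF // (lt_trans pv).
split.
- move=> [l _ /= [E1 E2]]; rewrite /slope /=; apply/eqP.
  by rewrite eqr_div //; apply/eqP; rewrite E1 E2; ring.
- rewrite /slope /= => /eqP; rewrite eqr_div // => /eqP E.
  exists ((v1 - p1) / (q1 - p1)) => /=.
    by rewrite divr_ge0 ?ler_pdivrMr; lra.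
  congr pair; first by field.
  apply: (mulIf d3).
  have -> : ((1 - (v1 - p1) / (q1 - p1)) * p2 + (v1 - p1) / (q1 - p1) * q2)
    * (q1 - p1) = (q1 - v1) * p2 + (v1 - p1) * q2 by field.
  lra.
Qed.

Hypothesis chain_b : is_chain b.

Lemma chain_adjacent s1 p q s2 : b = s1 ++ p :: q :: s2 ->
  mono p q /\ (p.1 = q.1 -> p.2 < q.2).
Proof.
move=> Eb; have := chain_b; rewrite /is_chain Eb => /cat_sorted2[_ /= /andP[]].
move=> /and3P[h1 h2 h3] _; split; first by rewrite /mono h1.
move=> E; rewrite lt_neqAle h2 andbT; apply: contra h3 => /eqP E2.
by rewrite (surjective_pairing p) E E2 -surjective_pairing.
Qed.

Lemma canonical_vertex_head : canonical_vertex (head (0, 0) b).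
Proof.
split; last by left; rewrite pval_head.
split; last by constructor 1.
by rewrite lexx; have /mono_head/andP[-> _] := mem_last_b.
Qed.

(** Away from both ends of the chain, everything depends on which of the two edges at [v] are
    vertical. *)
Lemma kept_vertex s1 v s2 : b = s1 ++ v :: s2 ->
  ~~ redundant b (size s1) && ~~ trailing b (size s1) <-> canonical_vertex v.
Proof.
move=> Eb; rewrite (trailing_at Eb).
have vb : v \in b by rewrite Eb mem_cat mem_head orbT.
have /andP[av _] := mono_head vb; have /andP[vu _] := mono_last vb.
case/lastP: s1 Eb => [|s1 p] Eb.
  have Ev : v = head (0, 0) b by rewrite Eb.
  split=> _; first by rewrite Ev; exact: canonical_vertex_head.
  rewrite /redundant /=; apply/nandP; right; apply/hasPn => w /mono_head.
  by rewrite -Ev => /andP[_]; rewrite leNgt => /negbTE ->; rewrite andbF.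
have Ebp : b = s1 ++ p :: v :: s2 by rewrite Eb cat_rcons.
have pb : p \in b by rewrite Ebp mem_cat mem_head orbT.
have /andP[ap _] := mono_head pb.
have [/andP[pv1 pv2] pvS] := chain_adjacent Ebp.
have beforev w : w \in b -> w.1 = v.1 -> p.1 < v.1 -> v.2 <= w.2.
  move=> wb wv lt_pv; have hsc := hs; rewrite Ebp in hsc wb.
  case: (sorted_mono_split hsc wb) => /andP[h1 h2] //.
  by move: lt_pv; rewrite ltNge -wv h1.
have no_trail : p.1 < v.1 ->
    has (fun w => (w.1 == v.1) && (w.2 < v.2)) b = false.
  move=> lt_pv; apply/negbTE/hasPn => w wb.
  by apply/nandP; case: eqP => [E|_]; [right; rewrite -leNgt beforev|left].
have trail : p.1 = v.1 ->
    has (fun w => (w.1 == v.1) && (w.2 < v.2)) b.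
  by move=> E; apply/hasP; exists p => //; rewrite E eqxx pvS.
have pval_lt : p.1 = v.1 -> pval h v.1 < v.2.
  move=> E; apply: le_lt_trans (pvS E).
  by apply: (pval_prefix Ebp); rewrite -E.
have pval_eq : p.1 < v.1 -> pval h v.1 = v.2.
  by move=> lt_pv; rewrite (pval_edge Ebp lt_pv) // lerp_right.
have inside : a <= v.1 <= u by rewrite av vu.
case: s2 Eb Ebp => [|q s2] Eb Ebp.
- have Eu : u = v.1 by rewrite /u Eb last_cat.
  have -> : redundant b (size (rcons s1 p)) = false.
    by rewrite /redundant Eb size_cat size_rcons /= addn1 ltnn.
  rewrite Eu eqxx /=; move: pv1; rewrite le_eqVlt => /orP[/eqP E|lt_pv].
    rewrite trail //=; split => // -[_ [E'|[/andP[]]]].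
      by have := pval_lt E; rewrite -E' ltxx.
    by rewrite Eu ltxx.
  rewrite no_trail //; split => // _; split; last by left; rewrite pval_eq.
  by split => //; constructor 2.
have Ebq : b = rcons s1 p ++ v :: q :: s2 by [].
have qb : q \in b by rewrite Eb mem_cat !inE eqxx !orbT.
have /andP[qu _] := mono_last qb.
have [/andP[vq1 vq2] vqS] := chain_adjacent Ebq.
rewrite (redundant_at Ebq).
have rlim_gt : v.1 = q.1 -> v.1 < u -> v.2 < rlim h v.1.
  move=> E vu'; apply: (lt_le_trans (vqS E)).
  by rewrite E; apply: rlim_ge => //; rewrite -E.
have not_last : v.1 < q.1 -> (v.1 == u) = false.
  by move=> lt_vq; apply/lt_eqF/(lt_le_trans lt_vq).
move: pv1; rewrite le_eqVlt => /orP[/eqP Epv|lt_pv];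
  move: vq1; rewrite le_eqVlt => /orP[/eqP Evq|lt_vq].
(* Inside a vertical run: [v] lies strictly above the value and, when the run is not trailing,
   strictly below the right limit. *)
- have seg : on_segment p v q.
    have h1 := pvS Epv; have h2 := vqS Evq.
    exists ((v.2 - p.2) / (q.2 - p.2)).
      by rewrite divr_ge0 ?ler_pdivrMr; lra.
    rewrite [LHS]surjective_pairing -Evq Epv; congr pair; first by ring.
    by field; lra.
  rewrite (asboolT seg) /=; split => // -[_ [E|[/andP[vu' _] E]]].
    by have := pval_lt Epv; rewrite -E ltxx.
  by have := rlim_gt Evq vu'; rewrite -E ltxx.
(* Top of a run followed by a non-vertical edge: [v] carries the right limit at a jump. *)
- rewrite asboolF; last first.
    move=> [l _ E]; have h1 := pvS Epv.
    have E1 : v.1 = (1 - l) * p.1 + l * q.1 by rewrite {1}E.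
    have E2 : v.2 = (1 - l) * p.2 + l * q.2 by rewrite {1}E.
    have : l * (q.1 - v.1) = 0 by rewrite Epv in E1; lra.
    move/eqP; rewrite mulf_eq0 subr_eq0 (gt_eqF lt_vq) orbF => /eqP l0.
    by move: h1; rewrite E2 l0; lra.
  rewrite not_last //=; split => // _.
  have vu' : v.1 < u by exact: lt_le_trans qu.
  have rl : rlim h v.1 = v.2 by rewrite (rlim_edge Ebq) // lerp_left.
  have jump : jumps h u v.1 by rewrite /jumps vu' rl pval_lt.
  by split; [split => //; constructor 3 | right; rewrite rl].
(* Bottom of a run: [v] carries the value. Its abscissa is a jump, or the right end of the domain if
   the run is trailing. *)
- rewrite asboolF; last first.
    move=> [l _ E]; have h1 := vqS Evq.
    have E1 : v.1 = (1 - l) * p.1 + l * q.1 by rewrite {1}E.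
    have E2 : v.2 = (1 - l) * p.2 + l * q.2 by rewrite {1}E.
    have : (1 - l) * (v.1 - p.1) = 0 by rewrite -Evq in E1; lra.
    move/eqP; rewrite mulf_eq0 subr_eq0 orbC subr_eq0 (gt_eqF lt_pv) /=.
    move=> /eqP l1; move: h1; by rewrite E2 -l1; lra.
  rewrite no_trail // andbF /=; split => // _.
  split; last by left; rewrite pval_eq.
  split => //; have [E|ne] := eqVneq v.1 u; first by constructor 2.
  have vu' : v.1 < u by rewrite lt_neqAle ne.
  by constructor 3; rewrite /jumps vu' pval_eq // rlim_gt.
(* No vertical edge: the function is continuous at [v.1], and [v] is redundant exactly when the two
   slopes agree. *)
- rewrite not_last //= andbT.
  have sl1 := slope_left_edge Ebp lt_pv (lexx _).
  have sl2 := slope_right_edge Ebq (lexx _) lt_vq.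
  have vu' : v.1 < u by exact: lt_le_trans qu.
  have av' : a < v.1 by exact: le_lt_trans lt_pv.
  have rl : rlim h v.1 = v.2 by rewrite (rlim_edge Ebq) // lerp_left.
  have seg := on_segment_slope lt_pv lt_vq.
  split.
  + move=> /asboolP nseg; split; last by left; rewrite pval_eq.
    split => //; constructor 4; split; first by rewrite av' vu'.
    exists (slope p v), (slope v q); split => // E.
    by apply: nseg; apply/seg.
  + move=> [[_ hcut] _]; apply/asboolP => /seg E.
    case: hcut => [E'|E'|/andP[_]|[_ [m1 [m2 [sm1 sm2 ne]]]]].
    * by move: av'; rewrite E' ltxx.
    * by move: vu'; rewrite E' ltxx.
    * by rewrite rl pval_eq // ltxx.
    * apply: ne; rewrite (slope_along_left_unique sm1 sl1).
      by rewrite (slope_along_right_unique sm2 sl2).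
Qed.

Lemma mem_reduced P : P \in reduced b <-> canonical_vertex P.
Proof.
split.
  move=> /mapP[k]; rewrite mem_filter mem_iota /= add0n => /andP[hk kb] EP.
  apply/(@kept_vertex (take k b) _ (drop k.+1 b)).
    by rewrite EP /vertex -drop_nth // cat_take_drop.
  by rewrite size_takel // ltnW.
move=> hP; have Pb := canonical_vertex_mem hP.
have [s1 [s2 Eb]] : exists s1 s2, b = s1 ++ P :: s2.
  exists (take (index P b) b), (drop (index P b).+1 b).
  by rewrite -{2}(nth_index P Pb) -drop_nth ?index_mem // cat_take_drop.
apply/mapP; exists (size s1); last by rewrite (vertex_at Eb).
rewrite mem_filter mem_iota /= add0n; apply/andP; split.
  exact/(kept_vertex Eb).
by rewrite Eb size_cat /=; lia.
Qed.

Lemma selected_FND : FND_on h a u.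
Proof.
split.
- split; first by rewrite /a /u; have /mono_head/andP[] := mem_last_b.
  apply/seteqP; split=> t /=; rewrite /pdom /= in_itv /= /h selected_isSome //.
- exact: pval_nondecreasing.
- exact: pval_left_continuous.
- exact: piecewise_selected.
Qed.
End Selected.

(** * Uniqueness of reduced forms and existence of the canonical chain *)

Definition chain_lt : rel (R * R) :=
  fun p q => [&& p.1 <= q.1, p.2 <= q.2 & p != q].

Lemma chain_lt_irr : irreflexive chain_lt.
Proof. by move=> p; rewrite /chain_lt eqxx !andbF. Qed.

Lemma chain_lt_trans : transitive chain_lt.
Proof.
move=> q p r /and3P[h1 h2 h3] /and3P[h4 h5 h6].
rewrite /chain_lt (le_trans h1 h4) (le_trans h2 h5) /=.
apply: contra h3 => /eqP E; rewrite -E in h4 h5.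
rewrite (surjective_pairing p) (surjective_pairing q) xpair_eqE.
by rewrite !eq_le h1 h2 h4 h5.
Qed.

Lemma subseq_chain s b : subseq s b -> is_chain b -> is_chain s.
Proof. exact: (subseq_sorted chain_lt_trans). Qed.

Lemma reduced_chain b : is_chain b -> is_chain (reduced b).
Proof.
apply: subseq_chain.
have {2}-> : b = [seq vertex b k | k <- iota 0 (size b)].
  by rewrite -[LHS](mkseq_nth (0, 0)).
exact/map_subseq/filter_subseq.
Qed.

Lemma split_nth (T : Type) (x0 : T) (s : seq T) k : (k < size s)%N ->
  exists s1 s2 : seq T, s = s1 ++ nth x0 s k :: s2 /\ size s1 = k.
Proof.
move=> hk; exists (take k s), (drop k.+1 s).
by rewrite -drop_nth // cat_take_drop size_takel // ltnW.
Qed.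

Lemma redundant_remove b k : is_chain b -> redundant b k ->
  exists b', [/\ is_chain b', b' != [::], selected b' = selected b &
    (size b' < size b)%N].
Proof.
move=> cb hk; have /and3P[k0 kb _] := hk.
have [s1 [s2 [Eb Ek]]] := split_nth (0, 0) (ltnW kb).
set v := nth _ _ _ in Eb.
case/lastP: s1 Ek Eb => [Ek|s1 p Ek]; first by rewrite -Ek in k0.
case: s2 => [|q s2] Eb.
  by move: kb; rewrite Eb size_cat Ek addn1 ltnn.
move: hk; rewrite -Ek (redundant_at Eb) => /asboolP seg.
have Eb' : b = s1 ++ p :: v :: q :: s2 by rewrite Eb cat_rcons.
have cb' : is_chain (s1 ++ p :: q :: s2).
  apply: subseq_chain cb; rewrite Eb'; apply: cat_subseq => //.
  exact: (cat_subseq (subseq_refl [:: p]) (subseq_cons (q :: s2) v)).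
exists (s1 ++ p :: q :: s2); split => //.
- by case: (s1).
- have ref : refine (p :: q :: s2) (p :: v :: q :: s2).
    by right; exists p, v, q, s2.
  by have [_ <-] := refine_cat ref (chain_mono cb'); rewrite Eb'.
- by rewrite Eb' !size_cat /=; lia.
Qed.

(** The point removed is the last one of the chain, not the [k]-th: it belongs to the same trailing
    run, above a lower point, so cutting it off changes no value. *)
Lemma trailing_remove b k : is_chain b -> (k < size b)%N -> trailing b k ->
  exists b', [/\ is_chain b', b' != [::], selected b' = selected b &
    (size b' < size b)%N].
Proof.
move=> cb kb /andP[/eqP hk /hasP[w wb /andP[/eqP w1 w2]]].
have vb : vertex b k \in b by exact: mem_nth.
have sb := chain_mono cb.
case/lastP: b cb kb hk wb w1 w2 vb sb => // s l cb kb hk wb w1 w2 vb sb.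
have El : vertex (rcons s l) (size (rcons s l)).-1 = l.
  by rewrite size_rcons /vertex /= nth_rcons ltnn eqxx.
rewrite El in hk.
have /andP[_] := mono_last sb vb; rewrite last_rcons => vl.
have ws : w \in s.
  move: wb; rewrite mem_rcons inE => /orP[/eqP E|//].
  by move: (lt_le_trans w2 vl); rewrite E ltxx.
have ns : s != [::] by case: (s) ws.
have [ss hl] : sorted mono s /\ mono (last (0, 0) s) l.
  by move: sb; rewrite sorted_mono_rcons // => /andP[].
have /andP[ls _] := mono_last ss ws.
exists s; split => //; last by rewrite size_rcons.
- by apply: subseq_chain cb; rewrite -cats1; exact: prefix_subseq.
- apply/funext => t; rewrite selected_rcons //; case: leP => // ht.
  rewrite selected_gt // ifN // -ltNge; apply: le_lt_trans ht.
  by rewrite -hk -w1.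
Qed.

(** Removing one point at a time makes it immediate that the function is preserved, which is less
    direct for [reduced], where all points go at once. [reduced_unique] then relates the result to
    [reduced b]. *)
Lemma irredundant_chain b : is_chain b -> b != [::] ->
  exists b', [/\ is_chain b', b' != [::], selected b' = selected b &
    reduced b' = b'].
Proof.
have [n] := ubnP (size b); elim: n b => // n IH b /ltnSE hn cb nb.
case: (boolP (has (fun k => redundant b k || trailing b k) (iota 0 (size b)))).
  move=> /hasP[k]; rewrite mem_iota /= add0n => kb hk.
  have [b1 [c1 n1 e1 l1]] : exists b', [/\ is_chain b', b' != [::],
      selected b' = selected b & (size b' < size b)%N].
    by case/orP: hk; [exact: redundant_remove | exact: trailing_remove].
  have [b2 [c2 n2 e2 r2]] := IH b1 (leq_trans l1 hn) c1 n1.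
  by exists b2; rewrite e2.
move=> /hasPn hall; exists b; split => //.
rewrite /reduced (eq_in_filter (a2 := predT)); last first.
  by move=> k /hall; rewrite negb_or.
by rewrite filter_predT; exact: mkseq_nth.
Qed.

Lemma domain_ends b (x y : R) : is_chain b -> b != [::] ->
  pdom (selected b) = `[x, y] ->
  (head (0, 0) b).1 = x /\ (last (0, 0) b).1 = y.
Proof.
move=> cb nb E; have sb := chain_mono cb.
have D t : ((head (0, 0) b).1 <= t <= (last (0, 0) b).1) = (x <= t <= y).
  have := congr1 (fun S : set R => S t) E; rewrite /pdom /= in_itv /=.
  by rewrite selected_isSome // => H; apply/idP/idP; rewrite H.
have /andP[h _] : mono (head (0, 0) b) (last (0, 0) b).
  by apply: mono_head => //; exact: mem_last_b.
have := D (head (0, 0) b).1; have := D (last (0, 0) b).1.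
rewrite !lexx h /= => /esym/andP[h1 h2] /esym/andP[h3 h4].
have xy : x <= y by exact: le_trans h2.
have := D x; have := D y; rewrite !lexx xy /= => /andP[h5 h6] /andP[h7 h8].
by split; apply/eqP; rewrite eq_le ?h2 ?h3 ?h6 ?h7.
Qed.

Lemma selected_domain b b' : is_chain b -> is_chain b' -> b != [::] ->
  b' != [::] -> selected b' = selected b ->
  (head (0, 0) b').1 = (head (0, 0) b).1 /\
  (last (0, 0) b').1 = (last (0, 0) b).1.
Proof.
move=> cb cb' nb nb' E; apply: domain_ends => //; rewrite E.
by have [[_ ->]] := selected_FND nb (chain_mono cb).
Qed.

Lemma reduced_unique b b' : is_chain b -> is_chain b' -> b != [::] ->
  b' != [::] -> selected b' = selected b -> reduced b = reduced b'.
Proof.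
move=> cb cb' nb nb' E; have [Eh El] := selected_domain cb cb' nb nb' E.
apply: (irr_sorted_eq chain_lt_trans chain_lt_irr); try exact: reduced_chain.
have H P : canonical_vertex b P <-> canonical_vertex b' P.
  by rewrite /canonical_vertex Eh El E.
have M := mem_reduced nb (chain_mono cb) cb.
have M' := mem_reduced nb' (chain_mono cb') cb'.
by move=> P; apply/idP/idP => [/M/H/M'|/M'/H/M].
Qed.

Lemma mem_cut_points h u t P : P \in cut_points h u t ->
  P.1 = t /\ (P.2 = pval h t \/ (jumps h u t /\ P.2 = rlim h t)).
Proof.
rewrite /cut_points inE => /orP[/eqP->|]; first by split; [|left].
by case: ifP => // j; rewrite inE => /eqP->; split; [|right].
Qed.

Lemma flatten_map_cons (T S : Type) (k : T -> seq S) x (r : seq T) :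
  flatten [seq k y | y <- x :: r] = k x ++ flatten [seq k y | y <- r].
Proof. by []. Qed.

(** The order of ordinates between different cuts is inherited from [b]: two points of a chain are
    comparable, and their distinct abscissae decide which one comes first. *)
Lemma canonical_sorted h u ts b : is_chain b -> sorted <%R ts ->
  {subset flatten [seq cut_points h u t | t <- ts] <= b} ->
  sorted chain_lt (flatten [seq cut_points h u t | t <- ts]).
Proof.
move=> cb hts hsub; rewrite (sorted_pairwise chain_lt_trans).
elim: ts hts hsub => // t ts IH hts hsub; rewrite flatten_map_cons pairwise_cat.
rewrite IH ?andbT; first last.
- by move=> P hP; apply: hsub; rewrite flatten_map_cons mem_cat hP orbT.
- exact: path_sorted hts.
apply/andP; split; last first.
  rewrite /cut_points; case: ifP => //= /andP[_ j].
  by rewrite /chain_lt /= lexx ltW //= xpair_eqE eqxx /= lt_eqF.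
apply/allrelP => P Q hP hQ.
have Pb : P \in b by apply: hsub; rewrite flatten_map_cons mem_cat hP.
have Qb : Q \in b by apply: hsub; rewrite flatten_map_cons mem_cat hQ orbT.
have [P1 _] := mem_cut_points hP.
have ltPQ : P.1 < Q.1.
  move: hQ => /flatten_mapP[t' ht' /mem_cut_points[-> _]]; rewrite P1.
  by move: hts => /= /(order_path_min lt_trans)/allP; exact.
have [s1 [s2 [Eb Es]]] := split_nth (0, 0) (etrans (index_mem Q b) Qb).
rewrite nth_index // in Eb.
move: (cb); rewrite /is_chain Eb (sorted_pairwise chain_lt_trans) pairwise_cat.
move=> /and3P[/allrelP h1 _ /= /andP[/allP h2 _]].
move: Pb; rewrite Eb mem_cat inE => /or3P[Ps|/eqP E|Ps].
- by apply: h1 => //; exact: mem_head.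
- by move: ltPQ; rewrite E ltxx.
- by move: ltPQ; have /and3P[h3 _ _] := h2 _ Ps; rewrite ltNge h3.
Qed.

Lemma reduced_canonical b : is_chain b -> b != [::] ->
  exists2 bc, is_canonical (selected b) bc &
    same_up_to_redundant_and_trailing b bc.
Proof.
move=> cb nb; have [b' [cb' nb' E Er]] := irredundant_chain cb nb.
exists b'; last exact: reduced_unique.
have sb' := chain_mono cb'.
pose a := (head (0, 0) b').1; pose u := (last (0, 0) b').1.
rewrite -E; exists a, u; split; first exact: selected_FND.
(* Every cut is the abscissa of a chain point, which provides a finite list to filter. *)
pose ts :=
  sort <=%R (undup [seq t <- unzip1 b' | `[< is_cut (selected b') a u t >]]).
have mem_ts t : t \in ts <-> is_cut (selected b') a u t.
  rewrite mem_sort mem_undup mem_filter; split=> [/andP[/asboolP]//|ht].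
  rewrite asboolT //=; have [w wb <-] := cut_abscissa nb' sb' ht.
  exact: map_f.
have mem_b P : P \in flatten [seq cut_points (selected b') u t | t <- ts] <->
    P \in b'.
  rewrite -{2}Er (mem_reduced nb' sb' cb'); split.
    move=> /flatten_mapP[t /mem_ts ht /mem_cut_points[E1 E2]].
    by split; rewrite E1.
  case: P => t y [/mem_ts/= ht hy]; apply/flatten_mapP; exists t => //.
  rewrite /cut_points; case: hy => [->|[j ->]]; first exact: mem_head.
  by rewrite j !inE eqxx orbT.
have sts : sorted <%R ts.
  by rewrite lt_sorted_uniq_le sort_uniq undup_uniq sort_le_sorted.
exists ts; split => //.
apply: (irr_sorted_eq chain_lt_trans chain_lt_irr) => //.
  by apply: (canonical_sorted cb') => // P /mem_b.
by move=> P; apply/idP/idP => /mem_b.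
Qed.
End Canonical.

Local Open Scope classical_set_scope.

Theorem theorem3p2 (R : realType) :
  exists C : nat,
  forall (f g : pfun R) (a_f u_f a_g u_g : R) (bf bg : seq (R * R)),
    FND f -> FND g -> f <> pbot -> g <> pbot ->
    pdom f = `[a_f, u_f] -> pdom g = `[a_g, u_g] ->
    a_f <= pval g a_g ->
    represents bf f -> represents bg g ->
    exists (bh : seq (R * R)) (c : nat),
      [/\ compose_returns bf bg bh c,
          (c <= C * (size bf + size bg))%N,
          bh = [::] <-> pcomp f g = pbot &
          pcomp f g <> pbot ->
          [/\ represents bh (pcomp f g),
              (size bh <= size bf + size bg)%N &
              exists2 bc : seq (R * R), is_canonical (pcomp f g) bc &
                same_up_to_redundant_and_trailing bh bc]].
Proof.
exists 1000%N => f g a_f u_f a_g u_g bf bg _ _ f0 g0 df dg hfg.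
move=> [cf ef] [cg eg].
have nf : bf != [::] by apply/eqP => E; apply: f0; rewrite -ef E.
have ng : bg != [::] by apply/eqP => E; apply: g0; rewrite -eg E.
have [bh [c [hret cK ch eh sh]]] : exists bh c,
    [/\ compose_returns bf bg bh c, (c <= 1000 * (size bf + size bg))%N,
      is_chain bh, selected bh = pcomp (selected bf) (selected bg) &
      (size bh <= size bf + size bg)%N].
  apply: compose_spec => //.
  (* The chains start at [a_f] and [a_g], and the first ordinate of [bg] is [g(a_g)]. *)
  have [-> _] := domain_ends cf nf (etrans (congr1 _ ef) df).
  have [hg _] := domain_ends cg ng (etrans (congr1 _ eg) dg).
  by move: hfg; rewrite -hg -eg pval_head //; exact: chain_mono.
rewrite ef eg in eh.
exists bh, c; split => //.
(* For the converse, a non-empty chain selects a value at its first abscissa. *)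
- split=> [E|E]; first by rewrite -eh E.
  apply/eqP/negPn/negP => nh; have := selected_head nh (chain_mono ch).
  by rewrite eh E.
- move=> nbot; have nh : bh != [::].
    by apply/eqP => E; apply: nbot; rewrite -eh E.
  split => //; rewrite -eh; exact: reduced_canonical.
Qed.
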